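(* Let $\mathcal G=(G_n)_{n\in\mathbb N}$ be an expander sequence and let $q\in(0,1]$. Then, for any choice of the initially informed vertex, with high probability (a) $T_{push}(G_n,q)=c_{push}(q)\log n+o(\log n)$, (b) $T_{pull}(G_n,q)=c_{pull}(q)\log n+o(\log n)$, (c) $T_{pp}(G_n,q)=c_{pp}(q)\log n+o(\log n)$.
   Context: Rumour spreading protocols on a connected graph $G=(V,E)$ with $n$ vertices, one vertex initially informed, proceeding in synchronous rounds; each message transmission succeeds independently with probability $q\in(0,1]$. push: in each round every informed vertex chooses a neighbour independently and uniformly at random and (if the transmission succeeds) informs it. pull: in each round every uninformed vertex chooses a neighbour independently and uniformly at random; if that neighbour is informed and the transmission succeeds, the asking vertex becomes informed. push\&pull (pp): in each round every vertex chooses a neighbour independently and uniformly at random, and if one of the two is informed (and the transmission succeeds) both become informed. $T_{\mathcal P}(G,q)$ is the number of rounds until all vertices are informed by protocol $\mathcal P\in\{push,pull,pp\}$. For $q\in(0,1)$: $c_{push}(q)=\frac{1}{\log(1+q)}+\frac1q$, $c_{pull}(q)=\frac{1}{\log(1+q)}-\frac{1}{\log(1-q)}$, $c_{pp}(q)=\frac{1}{\log(1+2q)}+\frac{1}{q-\log(1-q)}$, and $c_{\mathcal P}(1)=\lim_{q\to1}c_{\mathcal P}(q)$; $\log$ is the natural logarithm. A $(n,\delta,\Delta,\lambda)$-graph is a connected graph on $n$ vertices with minimum degree $\delta$, maximum degree $\Delta$, and $\lambda=\max\{|\mu_2|,|\mu_n|\}$ where $\mu_1\ge\dots\ge\mu_n$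 are the adjacency eigenvalues. A sequence $(G_n)$ with $G_n$ an $(n,\delta_n,\Delta_n,\lambda_n)$-graph is an expander sequence if $\Delta_n/\delta_n=1+o(1)$ and $\lambda_n=o(\Delta_n)$. ''With high probability'' (whp) means with probability $1-o(1)$ as $n\to\infty$. $a=b+o(f)$ means $a\in[b-g,b+g]$ for some positive $g=o(f)$; $a\le b+o(f)$ means $a\le b+g$ for some positive $g=o(f)$. *)

(* Defs.v *)
From HB Require Import structures.
From mathcomp Require Import all_boot all_order all_algebra.
From mathcomp Require Import all_classical all_reals all_analysis.
Set Implicit Arguments. Unset Strict Implicit. Unset Printing Implicit Defensive.
Import Order.TTheory GRing.Theory Num.Theory.
Import numFieldNormedType.Exports.
Local Open Scope ring_scope.

Definition simple_graph (T : finType) (e : rel T) : Prop :=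
  symmetric e /\ irreflexive e.
Definition connected_graph (T : finType) (e : rel T) : Prop :=
  forall u v : T, connect e u v.

Definition deg (T : finType) (e : rel T) (u : T) : nat := #|[pred w | e u w]|.
Definition maxdeg (T : finType) (e : rel T) : nat := \max_(u : T) deg e u.
Definition mindeg (T : finType) (e : rel T) : nat :=
  \big[minn/#|T|]_(u : T) deg e u.

Definition adjmx (R : realType) (n : nat) (e : rel 'I_n) : 'M[R]_n :=
  \matrix_(i, j) (e i j)%:R.

Definition adj_spectrum (R : realType) (n : nat) (e : rel 'I_n) (s : seq R) : Prop :=
  [/\ size s = n, sorted (fun x y => y <= x) s &
      char_poly (adjmx R e) = \prod_(x <- s) ('X - x%:P)].

(* lambda = max{|mu_2|, |mu_n|} (0-based indices 1 and n-1) *)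
Definition spec_lambda (R : realType) (n : nat) (s : seq R) : R :=
  Num.max `|s`_1| `|s`_(n.-1)|.

Definition expander_sequence (R : realType) (G : forall n, rel 'I_n.+1) : Prop :=
  (forall n, simple_graph (G n) /\ connected_graph (G n)) /\
  ((fun n => (maxdeg (G n))%:R / (mindeg (G n))%:R : R) @ \oo --> (1 : R))%classic /\
  (exists spec : nat -> seq R,
      (forall n, adj_spectrum (G n) (spec n)) /\
      ((fun n => spec_lambda n.+1 (spec n) / (maxdeg (G n))%:R) @ \oo --> (0 : R))%classic).

Inductive protocol := Push | Pull | PushPull.

Section Rumour.
Variables (R : realType) (T : finType) (e : rel T).

(* uniform choice of a neighbour (a vertex without neighbours "chooses itself",
   which has no effect; this case never occurs for connected graphs with >= 2
   vertices) *)
Definition choice_w (u w : T) : R :=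
  if deg e u == 0%N then (w == u)%:R else (e u w)%:R / (deg e u)%:R.

(* randomness of one round: each vertex u picks a vertex (c u).1 and a
   transmission-success bit (c u).2 (success with probability q), all
   independent *)
Definition config := {ffun T -> T * bool}.

Definition config_w (q : R) (c : config) : R :=
  \prod_(u : T) (choice_w u (c u).1 * (if (c u).2 then q else 1 - q)).

Definition step (P : protocol) (I : {set T}) (c : config) : {set T} :=
  let pushed := finset [pred w | [exists u, [&& u \in I, (c u).1 == w & (c u).2]]] in
  let pulled := finset [pred w | ((c w).1 \in I) && (c w).2] in
  match P with
  | Push => I :|: pushed
  | Pull => I :|: pulled
  | PushPull => I :|: pushed :|: pulled
  end.

Fixpoint state (P : protocol) (v : T) (t : nat) (om : {ffun 'I_t -> config})
    (k : nat) : {set T} :=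
  match k with
  | 0 => [set v]
  | k'.+1 => match insub k' with
             | Some i => step P (state P v om k') (om i)
             | None => state P v om k'
             end
  end.

Definition Pr_rounds (q : R) (t : nat) (E : pred {ffun 'I_t -> config}) : R :=
  \sum_(om | E om) \prod_(i < t) config_w q (om i).

Definition T_between_ev (P : protocol) (v : T) (a b : R) (t : nat)
    (om : {ffun 'I_t -> config}) : bool :=
  [exists k : 'I_t.+1,
     [&& a <= (k : nat)%:R, (k : nat)%:R <= b,
         state P v om k == [set: T]%SET & [forall j : 'I_k, state P v om j != [set: T]%SET]]].

(* Prob(a <= T_P(G, q) <= b), started from informed vertex v; it suffices to
   look at the first floor(b) rounds. *)
Definition Prob_T_between (P : protocol) (q : R) (v : T) (a b : R) : R :=
  Pr_rounds q (T_between_ev P v a b (t := Num.truncn b)).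

End Rumour.

Section Consts.
Variable R : realType.
Definition cpush_f (q : R) : R := 1 / ln (1 + q) + 1 / q.
Definition cpull_f (q : R) : R := 1 / ln (1 + q) - 1 / ln (1 - q).
Definition cpp_f (q : R) : R := 1 / ln (1 + 2 * q) + 1 / (q - ln (1 - q)).
Definition cconst (f : R -> R) (q : R) : R :=
  if q < 1 then f q else lim (f x @[x --> at_left 1])%classic.
Definition c_protocol (P : protocol) : R -> R :=
  match P with
  | Push => cconst cpush_f
  | Pull => cconst cpull_f
  | PushPull => cconst cpp_f
  end.
End Consts.

Definition whp_time (R : realType) (G : forall n, rel 'I_n.+1) (P : protocol)
    (q : R) (v : forall n, 'I_n.+1) : Prop :=
  exists g : nat -> R,
    (forall n, 0 < g n) /\
    ((fun n => g n / ln (n.+1)%:R) @ \oo --> (0 : R))%classic /\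
    ((fun n => Prob_T_between (G n) P q (v n)
                 (c_protocol P q * ln (n.+1)%:R - g n)
                 (c_protocol P q * ln (n.+1)%:R + g n)) @ \oo --> (1 : R))%classic.

(* Main.v *)
(** Let I be the set of informed vertices, U its complement, g = q([push used] + [pull used]) and
    r = e^(-q [push used]) (1 - q [pull used]).

    In one round, the events that two given vertices of U stay uninformed are negatively correlated, so the
    variance of |U'| is at most min(E|U'|, |U| - E|U'|).  The expander property bounds
    sum_w d_S(w)^2 by D^2 |S| ((1+o(1))|S|/n + o(1)) for every vertex set S, where d_S(w) counts the neighbours
    of w in S.  Hence a small I grows in mean by the factor 1 + g + o(1), a small U shrinks in mean by the
    factor r + o(1), in between U shrinks by a constant factor, and never does I grow faster than 1 + g + o(1)
    nor U shrink faster than r - o(1).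

    The variance bound makes E[1/|I'|] almost 1/E|I'|.  Multiplying the one-step bounds for 1/|I|, then for |U|,
    shows that all vertices are informed after (1/log(1+g) + 1/log(1/r) + eps) log n rounds.  Conversely the
    one-step bound for |I| shows that half of the vertices are still uninformed after
    (1/log(1+g) - eps) log n rounds, and from there on the one-step bound for 1/(K + |U|) shows that U survives
    for another (1/log(1/r) - eps) log n rounds.  If r = 0 (q = 1 with pull), the last phase takes o(log n)
    rounds. *)

Require Import Defs.
From HB Require Import structures.
From mathcomp Require Import all_boot all_order all_algebra.
From mathcomp Require Import all_classical all_reals all_analysis.
From mathcomp Require Import complex lra ring.
Import Order.TTheory GRing.Theory Num.Theory.
Import numFieldNormedType.Exports.
Set Implicit Arguments. Unset Strict Implicit. Unset Printing Implicit Defensive.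
Local Open Scope ring_scope.

(** * Spectral bound on overlaps of neighbourhoods *)

(** First moments suffice where a set must not be too large: Markov's inequality for |I| and |U|.
    Where it must not be too small they say nothing, because a large mean may come from rare
    outcomes; hence the reciprocals. The relative variance error of 1/|I| is of order 1/|I|, which
    is not small at the start, so a constant number of initial rounds uses a weaker contraction
    factor. The set U, unlike I, may become empty, hence the shift by a constant K, which also makes
    the variance error as small as desired.

    The push factor of r is a limit of (1 - q/D)^D and so needs degrees tending to infinity. This is
    not assumed; it follows from the overlap bound applied to a single vertex. The overlap bound
    itself cannot start from a constant top eigenvector, as the graphs are only nearly regular.

    Probabilities are expressed by iterates of a transition operator on functions of I, so that a
    phase is an inequality between functions and phases are composed by monotonicity. *)

Lemma char_poly_conj (F : fieldType) (n : nat) (P D : 'M[F]_n) :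
  P \in unitmx -> char_poly (invmx P *m D *m P) = char_poly D.
Proof.
move=> uP; rewrite /char_poly /char_poly_mx.
pose C (M : 'M[F]_n) := map_mx polyC M.
have uP' : C P \in unitmx by rewrite map_unitmx.
have -> : 'X%:M - C (invmx P *m D *m P) =
    invmx (C P) *m ('X%:M - C D) *m C P.
  rewrite mulmxBr mulmxBl scalar_mxC -(mulmxA _ (invmx _)) mulVmx // mulmx1.
  by rewrite /C !map_mxM /= map_invmx.
rewrite !det_mulmx mulrC mulrA -det_mulmx mulmxV // det1 mul1r //.
Qed.

Lemma sum_sqr_rowC (R : rcfType) (n : nat) (y : 'rV[R[i]]_n) :
  (y *m (map_mx Num.conj y^T)) 0 0 =
  (\sum_j (complex.Re (y 0 j) ^+ 2 + complex.Im (y 0 j) ^+ 2))%:C%C.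
Proof.
rewrite mxE rmorph_sum /=; apply: eq_bigr => j _.
by rewrite !mxE add_Re2_Im2 sqr_normc.
Qed.

(* a and b are the real and imaginary parts of a unit eigenvector for x0; the spectral theorem is only
   available over the complex numbers. *)
Lemma spectral_row_bound (R : rcfType) (n : nat) (A : 'M[R]_n) (x0 : R) (s : seq R)
    (lam D : R) :
  A^T = A -> char_poly A = \prod_(x <- x0 :: s) ('X - x%:P) ->
  (forall x, x \in s -> `|x| <= lam) -> `|x0| <= D ->
  exists a b : 'I_n -> R, \sum_i (a i ^+ 2 + b i ^+ 2) = 1 /\
    forall x : 'rV[R]_n, \sum_i (x *m A) 0 i ^+ 2 <= lam ^+ 2 * (\sum_i x 0 i ^+ 2)
       + D ^+ 2 * ((\sum_i x 0 i * a i) ^+ 2 + (\sum_i x 0 i * b i) ^+ 2).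
Proof.
move=> symA chA slam x0D.
pose toC := real_complex R.
pose AC := map_mx toC A.
have realE (z : R) : (toC z)^* = toC z.
  by apply/conj_Creal; rewrite complex_real.
have hAC : AC \is hermsymmx.
  apply/is_hermitianmxP; rewrite expr0 scale1r; apply/matrixP => i j.
  by rewrite !mxE realE -[in LHS]symA mxE.
have nAC := hermitian_normalmx hAC.
have /orthomx_spectralP EA := nAC.
set P := spectralmx AC in EA; set d := spectral_diag AC in EA.
have uP : P \is unitarymx := spectral_unitarymx AC.
have chD : \prod_i ('X - (d 0 i)%:P) = ('X - (toC x0)%:P) * \prod_(x <- s) ('X - (toC x)%:P).
  have <- : char_poly AC = \prod_i ('X - (d 0 i)%:P).
    rewrite EA char_poly_conj ?spectral_unit // char_poly_trig ?diag_mx_is_trig //.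
    by apply: eq_bigr => i _; rewrite mxE eqxx.
  rewrite -map_char_poly chA big_cons rmorphM /= rmorph_prod /= map_polyXsubC.
  by congr (_ * _); apply: eq_bigr => i _; rewrite map_polyXsubC.
have [k dk] : exists k, d 0 k = toC x0.
  have : root (\prod_i ('X - (d 0 i)%:P)) (toC x0).
    by rewrite chD rootM root_XsubC eqxx.
  rewrite /root horner_prod prodf_seq_eq0 => /hasP[k _ /=].
  by rewrite hornerXsubC subr_eq0 => /eqP ->; exists k.
have dj j : j != k -> exists2 x, x \in s & d 0 j = toC x.
  move=> jk; have : root (\prod_(x <- s) ('X - (toC x)%:P)) (d 0 j).
    (* One factor for [x0] is cancelled before the remaining roots are compared, so that a repeated
       eigenvalue [x0] is handled correctly. *)
    have: \prod_(x <- s) ('X - (toC x)%:P) = \prod_(i | i != k) ('X - (d 0 i)%:P).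
      apply: (@mulfI _ ('X - (toC x0)%:P)); first by rewrite polyXsubC_eq0.
      by rewrite -chD (bigD1 k) //= dk.
    move=> ->; rewrite (bigD1 j) //= rootM root_XsubC eqxx //.
  rewrite /root horner_prod prodf_seq_eq0 => /hasP[x xs /=].
  by rewrite hornerXsubC subr_eq0 => /eqP ->; exists x.
have PP : P *m map_mx Num.conj P^T = 1%:M by exact/unitarymxP.
have toCre (u : 'rV[R]_n) : (map_mx toC u *m map_mx Num.conj (map_mx toC u)^T) 0 0 =
    toC (\sum_j u 0 j ^+ 2).
  rewrite sum_sqr_rowC; congr toC; apply: eq_bigr => j _.
  by rewrite !mxE /= expr0n /= addr0.
exists (fun i => complex.Re (P k i)), (fun i => complex.Im (P k i)); split.
  apply: (@complexI R); have := congr1 (fun M : 'M[R[i]]_n => M k k) PP.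
  rewrite /= [RHS]mxE eqxx => PPk; apply: etrans PPk.
  have := sum_sqr_rowC (row k P); rewrite mxE [X in _ = X -> _](_ : _ =
    (\sum_i (complex.Re (P k i) ^+ 2 + complex.Im (P k i) ^+ 2))%:C%C).
    by move=> <-; rewrite [in RHS]mxE; apply: eq_bigr => j _; rewrite !mxE.
  by congr (_%:C%C); apply: eq_bigr => j _; rewrite !mxE.
move=> x; pose y := map_mx toC x *m map_mx Num.conj P^T.
have yE : map_mx toC x = y *m P.
  rewrite /y -mulmxA -invmx_unitary // mulVmx ?spectral_unit // mulmx1 //.
pose nq (z : R[i]) := complex.Re z ^+ 2 + complex.Im z ^+ 2.
have nq_ge0 z : 0 <= nq z by rewrite addr_ge0 ?sqr_ge0.
have nqM z z' : nq (z * z') = nq z * nq z'.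
  by case: z z' => [u v] [u' v']; rewrite /nq /=; ring.
have unit_inv (u : 'rV[R[i]]_n) :
    (u *m P) *m map_mx Num.conj (u *m P)^T = u *m map_mx Num.conj u^T.
  rewrite trmx_mul map_mxM /= -!mulmxA (mulmxA P) PP mul1mx //.
have EAx : \sum_i (x *m A) 0 i ^+ 2 = \sum_j nq (d 0 j) * nq (y 0 j).
  apply: (@complexI R); rewrite -[LHS]toCre map_mxM /= -/AC yE EA.
  rewrite !mulmxA mulmxK ?spectral_unit // unit_inv sum_sqr_rowC; congr toC.
  apply: eq_bigr => j _; rewrite mul_mx_diag mxE -/(nq _) mulrC nqM //.
have Ex : \sum_i x 0 i ^+ 2 = \sum_j nq (y 0 j).
  by apply: (@complexI R); rewrite -[LHS]toCre yE unit_inv sum_sqr_rowC.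
have Eyk : nq (y 0 k) = (\sum_i x 0 i * complex.Re (P k i)) ^+ 2 +
    (\sum_i x 0 i * complex.Im (P k i)) ^+ 2.
  have -> : y 0 k = (\sum_i x 0 i * complex.Re (P k i))%:C%C -
     'i%C * (\sum_i x 0 i * complex.Im (P k i))%:C%C.
    rewrite mxE !rmorph_sum /= mulr_sumr -sumrB; apply: eq_bigr => i _.
    rewrite !mxE /toC [P k i]complexE !rmorphM /= rmorphD rmorphM /=.
    rewrite complexiE conjCi -!complexiE.
    rewrite !realE /toC /=.
    ring.
  by rewrite /nq /=; ring.
rewrite EAx Ex -Eyk [in leLHS](bigD1 k) //= addrC [in leRHS](bigD1 k) //=.
have nqr z : nq (toC z) = z ^+ 2 by rewrite /nq /= expr0n addr0.
have sq (z t : R) : `|z| <= t -> z ^+ 2 <= t ^+ 2.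
  by move=> zt; rewrite -[z ^+ 2]real_normK ?num_real // lerXn2r ?nnegrE //; apply: le_trans zt.
apply: lerD; last by rewrite dk nqr ler_wpM2r // sq.
apply: le_trans (_ : lam ^+ 2 * (\sum_(i | i != k) nq (y 0 i)) <= _); last first.
  by rewrite ler_wpM2l ?sqr_ge0 // lerDr.
rewrite mulr_sumr; apply: ler_sum => j /dj[z zs ->].
by rewrite nqr ler_wpM2r // sq // slam.
Qed.

(** * Quadratic inequalities and neighbour counts *)

Lemma weighted_cauchy_schwarz (R : realFieldType) (I : finType) (P : pred I) (w x : I -> R) :
  0 < \sum_(i | P i) w i -> (forall i, P i -> 0 <= w i) ->
  (\sum_(i | P i) w i * x i) ^+ 2 <=
  (\sum_(i | P i) w i) * (\sum_(i | P i) w i * x i ^+ 2).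
Proof.
set W := \sum_(i | P i) w i; set m := \sum_(i | P i) w i * x i.
set Q := \sum_(i | P i) w i * x i ^+ 2 => W0 w0.
have : 0 <= \sum_(i | P i) w i * (W * x i - m) ^+ 2.
  by apply: sumr_ge0 => i Pi; rewrite mulr_ge0 ?w0 ?sqr_ge0.
have -> : \sum_(i | P i) w i * (W * x i - m) ^+ 2 = W * (W * Q - m ^+ 2).
  rewrite (eq_bigr (fun i => W ^+ 2 * (w i * x i ^+ 2) - 2 * W * m * (w i * x i) + m ^+ 2 * w i)).
    by rewrite big_split sumrB /= -!mulr_sumr -/m -/Q -/W; ring.
  by move=> i _; ring.
by rewrite pmulr_rge0 // subr_ge0.
Qed.

Lemma sqr_sum_le_card (R : realFieldType) (I : finType) (P : pred I) (x : I -> R) :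
  (\sum_(i | P i) x i) ^+ 2 <= #|P|%:R * (\sum_(i | P i) x i ^+ 2).
Proof.
have [P0|P0] := eqVneq #|P| 0%N.
  have PF i : P i = false := card0_eq P0 i.
  by rewrite !big_pred0 // P0 mul0r expr0n.
have PE : \sum_(i | P i) 1 = #|P|%:R :> R by rewrite sumr_const.
have := @weighted_cauchy_schwarz R I P (fun=> 1) x; rewrite PE ltr0n lt0n.
under eq_bigr do rewrite mul1r.
under [X in _ <= _ * X]eq_bigr do rewrite mul1r.
by apply.
Qed.

Lemma mindeg_le (T : finType) (e : rel T) (u : T) : (mindeg e <= deg e u)%N.
Proof.
have : u \in index_enum T by rewrite mem_index_enum.
rewrite /mindeg; elim: (index_enum T) => // a s IH; rewrite big_cons in_cons.
by case/predU1P => [<-|/IH]; [exact: geq_minl | apply: leq_trans; exact: geq_minr].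
Qed.

Lemma maxdeg_ge (T : finType) (e : rel T) (u : T) : (deg e u <= maxdeg e)%N.
Proof. exact: leq_bigmax. Qed.

Definition nbrs (R : realType) (T : finType) (e : rel T) (S : {set T}) (w : T) : R :=
  \sum_(u in S) (e u w)%:R.

Section Nbrs.
Variables (R : realType) (T : finType) (e : rel T).
Hypothesis symE : symmetric e.
Local Notation nbrs := (nbrs R e).

Lemma degE (u : T) : (deg e u)%:R = \sum_w (e u w)%:R :> R.
Proof. by rewrite /deg -sum1_card natr_sum big_mkcond; apply: eq_bigr => w _; case: ifP; rewrite inE => ->. Qed.

Lemma nbrs_ge0 S w : 0 <= nbrs S w.
Proof. by apply: sumr_ge0 => u _; rewrite ler0n. Qed.

Lemma nbrsC S w : nbrs S w + nbrs (~: S) w = (deg e w)%:R.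
Proof.
rewrite degE (bigID (mem S)) /=; congr (_ + _).
  by apply: eq_bigr => u _; rewrite symE.
by apply: eq_big => [u|u _]; rewrite ?inE // symE.
Qed.

Lemma sum_nbrs_sym (S S' : {set T}) : \sum_(w in S') nbrs S w = \sum_(w in S) nbrs S' w.
Proof. by rewrite exchange_big /=; apply: eq_bigr => u _; apply: eq_bigr => w _; rewrite symE. Qed.

Lemma nbrs_le_deg S w : nbrs S w <= (deg e w)%:R.
Proof. by rewrite -(nbrsC S) lerDl nbrs_ge0. Qed.

End Nbrs.

Section SpectralGraph.
Variables (R : realType) (N : nat) (e : rel 'I_N) (sp : seq R) (d D lam : R).
Hypothesis symE : symmetric e.
Hypothesis N1 : (1 < N)%N.
Hypothesis specE : adj_spectrum e sp.
Hypothesis lamE : lam = spec_lambda N sp.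
Hypothesis degd : forall u, d <= (deg e u)%:R <= D.
Hypothesis d0 : 0 < d.

(** Schur test: Cauchy-Schwarz with the edge weights at [i] costs one factor D, the degree of [i];
    exchanging the sums costs the second one. *)
Lemma adjmx_norm (x : 'rV[R]_N) :
  \sum_i (x *m adjmx R e) 0 i ^+ 2 <= D ^+ 2 * \sum_i x 0 i ^+ 2.
Proof.
have D0 : 0 <= D by case/andP: (degd (Ordinal (ltnW N1))) => /(lt_le_trans d0) /ltW /le_trans; apply.
apply: le_trans (_ : \sum_i D * \sum_u (e u i)%:R * x 0 u ^+ 2 <= _).
  apply: ler_sum => i _; rewrite mxE; under eq_bigr do rewrite mxE mulrC.
  have dE : \sum_(u : 'I_N) (e u i)%:R = (deg e i)%:R :> R.
    by rewrite degE; apply: eq_bigr => u _; rewrite symE.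
  have /andP[dd dD] := degd i.
  apply: le_trans (weighted_cauchy_schwarz (fun u => x 0 u) _ _) _.
  - by rewrite dE (lt_le_trans d0).
  - by move=> u _; rewrite ler0n.
  rewrite dE ler_wpM2r //; apply: sumr_ge0 => u _.
  by rewrite mulr_ge0 ?ler0n ?sqr_ge0.
rewrite -mulr_sumr expr2 -mulrA ler_wpM2l // exchange_big mulr_sumr /=.
apply: ler_sum => u _; rewrite -mulr_suml -degE ler_wpM2r ?sqr_ge0 //.
by case/andP: (degd u).
Qed.

(** The first eigenvalue is bounded by the operator norm. Every other one lies between the second
    and the last of the sorted list, so its absolute value is at most the larger of theirs. *)
Lemma adjmx_top_eigenvalue : exists s, sp = sp`_0 :: s /\ `|sp`_0| <= D /\
  (forall x, x \in s -> `|x| <= lam).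
Proof.
have D0 : 0 <= D by case/andP: (degd (Ordinal (ltnW N1))) => /(lt_le_trans d0) /ltW /le_trans; apply.
have [sz so ch] := specE.
case: sp sz so ch lamE => [|x0 s]; first by move=> /= h; exfalso; move: N1; rewrite -h.
move=> sz so ch ->; exists s; split => //=; split.
  have : eigenvalue (adjmx R e) x0.
    by rewrite eigenvalue_root_char ch big_cons rootM root_XsubC eqxx.
  case/eigenvalueP => v vA v0.
  have Q0 : 0 < \sum_i v 0 i ^+ 2.
    rewrite lt_def sumr_ge0 ?andbT; last by move=> i _; rewrite sqr_ge0.
    apply: contra v0; rewrite psumr_eq0; last by move=> i _; rewrite sqr_ge0.
    move=> /allP h; apply/eqP/rowP => i; rewrite mxE.
    by have /h/= := mem_index_enum i; rewrite sqrf_eq0 => /eqP.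
  have := adjmx_norm v; rewrite vA.
  under eq_bigr do rewrite mxE exprMn.
  rewrite -mulr_sumr ler_pM2r // -(real_normK (num_real x0)).
  by rewrite ler_pXn2r ?nnegrE.
move=> x /(nthP 0)[i si <-].
have tr : transitive (fun x y : R => y <= x) by move=> a b c h1 h2; exact: le_trans h2 h1.
have rf : reflexive (fun x y : R => y <= x) by move=> a; exact: lexx.
have szs : size s = N.-1 by rewrite -sz.
have N20 : (N.-1 < size (x0 :: s))%N by rewrite sz prednK ?ltnSn // ltnW.
have up : (x0 :: s)`_i.+1 <= (x0 :: s)`_1.
  by apply: (sorted_leq_nth tr rf 0 so); rewrite ?inE ?ltnS //; case: (s) si.
have dn : (x0 :: s)`_N.-1 <= (x0 :: s)`_i.+1.
  by apply: (sorted_leq_nth tr rf 0 so); rewrite ?inE ?ltnS // -szs.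
rewrite [s`_i](_ : _ = (x0 :: s)`_i.+1) // /spec_lambda le_max.
move: up dn; set a := _`_1; set b := _`_N.-1; set c := _`_i.+1 => up dn.
have [c0|/ltW c0] := leP 0 c.
  by rewrite (ger0_norm c0) (ger0_norm (le_trans c0 up)) up.
by rewrite (ler0_norm c0) (ler0_norm (le_trans dn c0)) lerN2 dn orbT.
Qed.

(** Weighted so that the coefficient of x^2 stays close to 1: the main term of the overlap bound
    must keep its constant. *)
Lemma sqrD_le (eta x y : R) : 0 < eta ->
  (x + y) ^+ 2 <= (1 + eta) * x ^+ 2 + (1 + eta^-1) * y ^+ 2.
Proof.
move=> eta0; rewrite -subr_ge0.
have -> : (1 + eta) * x ^+ 2 + (1 + eta^-1) * y ^+ 2 - (x + y) ^+ 2
   = eta^-1 * (eta * x - y) ^+ 2 by field; rewrite gt_eqF.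
by rewrite mulr_ge0 ?sqr_ge0 // invr_ge0 ltW.
Qed.

(** Applying the spectral bound to the all-ones vector shows that the top eigenvector is nearly
    constant. Hence the indicator of S projects on it with square about |S|^2 / N, and the rest of
    the indicator contributes at most lam^2 |S|. *)
Lemma nbrs_sqr_le (eta : R) (S : {set 'I_N}) : 0 < eta ->
  (lam / D) ^+ 2 + (1 + eta^-1) * (1 - (d / D) ^+ 2 + (lam / D) ^+ 2) <= eta ->
  \sum_w nbrs R e S w ^+ 2 <=
  D ^+ 2 * (#|S|%:R * ((1 + eta) * (#|S|%:R / N%:R) + eta)).
Proof.
move=> eta0 Heta.
have D0 : 0 < D.
  case/andP: (degd (Ordinal (ltnW N1))) => /(lt_le_trans d0) h1 h2.
  exact: lt_le_trans h2.
have N0 : 0 < N%:R :> R by rewrite ltr0n ltnW.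
have [-> | S0] := eqVneq S finset.set0.
  rewrite cards0 mul0r mulr0 big1 // => w _; rewrite /nbrs big_set0 expr0n //.
have cS : 0 < #|S|%:R :> R by rewrite ltr0n card_gt0.
have [s [spE [s0D slam]]] := adjmx_top_eigenvalue.
have [_ _ ch] := specE; rewrite spE in ch.
have symA : (adjmx R e)^T = adjmx R e by apply/matrixP => i j; rewrite !mxE symE.
have [a [b [ab1 bnd]]] := spectral_row_bound symA ch slam s0D.
pose xS : 'rV[R]_N := \row_i (i \in S)%:R.
have sumS (f : 'I_N -> R) : \sum_i xS 0 i * f i = \sum_(i in S) f i.
  rewrite [RHS]big_mkcond; apply: eq_bigr => i _; rewrite mxE.
  by case: ifP; rewrite ?mul1r ?mul0r.
have := bnd xS; rewrite !sumS.
have -> : \sum_(i in S) xS 0 i = #|S|%:R.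
  by rewrite -sum1_card natr_sum; apply: eq_bigr => i iS; rewrite mxE iS.
have -> : \sum_i (xS *m adjmx R e) 0 i ^+ 2 = \sum_w nbrs R e S w ^+ 2.
  apply: eq_bigr => i _; congr (_ ^+ 2); rewrite mxE sumS.
  by apply: eq_bigr => u _; rewrite mxE.
move=> main.
have := bnd (const_mx 1).
have c1 (f : 'I_N -> R) : \sum_i (const_mx 1 : 'rV[R]_N) 0 i * f i = \sum_i f i.
  by apply: eq_bigr => i _; rewrite mxE mul1r.
rewrite !c1.
have -> : \sum_i (const_mx 1 : 'rV[R]_N) 0 i = N%:R.
  under eq_bigr do rewrite mxE.
  by rewrite sumr_const card_ord.
have dlow : N%:R * d ^+ 2 <= \sum_i ((const_mx 1 : 'rV[R]_N) *m adjmx R e) 0 i ^+ 2.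
  rewrite mulr_natl -[X in _ *+ X]card_ord -sumr_const; apply: ler_sum => i _.
  rewrite mxE c1; under eq_bigr do rewrite mxE symE.
  rewrite -degE lerXn2r ?nnegrE ?ler0n ?(ltW d0) //.
  by case/andP: (degd i).
move=> /(le_trans dlow) => {dlow}.
set A := \sum_i a i; set B := \sum_i b i => top.
(* Only the component of f orthogonal to the all-ones vector depends on which S of a given size is chosen. *)
have dev (f : 'I_N -> R) : (\sum_(i in S) f i) ^+ 2 <=
    (1 + eta) * (#|S|%:R * ((\sum_i f i) / N%:R)) ^+ 2 +
    (1 + eta^-1) * (#|S|%:R * (\sum_i f i ^+ 2 - (\sum_i f i) ^+ 2 / N%:R)).
  set F := \sum_i f i; pose m := F / N%:R.
  have -> : \sum_(i in S) f i = #|S|%:R * m + \sum_(i in S) (f i - m).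
    by rewrite sumrB sumr_const mulr_natl addrCA subrr addr0.
  apply: le_trans (sqrD_le _ _ eta0) _; rewrite lerD2l ler_wpM2l //.
    by rewrite addr_ge0 // invr_ge0 ltW.
  apply: le_trans (sqr_sum_le_card _ _) _; rewrite ler_wpM2l ?(ltW cS) //.
  apply: le_trans (_ : \sum_i (f i - m) ^+ 2 <= _).
    by rewrite [leRHS](bigID (mem S)) /= lerDl sumr_ge0 // => i _; rewrite sqr_ge0.
  have -> : \sum_i (f i - m) ^+ 2 = \sum_i f i ^+ 2 - 2 * m * F + N%:R * m ^+ 2.
    rewrite (eq_bigr (fun i => f i ^+ 2 - 2 * m * f i + m ^+ 2)); last by move=> i _; ring.
    by rewrite big_split sumrB /= -mulr_sumr sumr_const card_ord [N%:R * _]mulr_natl.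
  by rewrite /m le_eqVlt; apply/orP; left; apply/eqP; field; rewrite gt_eqF.
have deva := dev a; have devb := dev b; rewrite -/A -/B in deva devb.
have ab : \sum_i a i ^+ 2 + \sum_i b i ^+ 2 = 1 by rewrite -big_split.
(* Z is the squared norm of the projection of the unit eigenvector on the normalised all-ones
   vector, and 1 - Z its squared distance from being constant. *)
pose Z := (A ^+ 2 + B ^+ 2) / N%:R.
have Z1 : Z <= 1.
  have cs (f : 'I_N -> R) : (\sum_i f i) ^+ 2 <= N%:R * \sum_i f i ^+ 2.
    by apply: le_trans (sqr_sum_le_card _ _) _; rewrite card_ord.
  rewrite /Z ler_pdivrMr // mul1r.
  have := lerD (cs a) (cs b); rewrite -mulrDr ab mulr1 //.
have Zd : 1 - Z <= 1 - (d / D) ^+ 2 + (lam / D) ^+ 2.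
  have h : d ^+ 2 <= lam ^+ 2 + D ^+ 2 * Z.
    rewrite -(ler_pM2l N0); apply: le_trans top _.
    rewrite le_eqVlt; apply/orP; left; apply/eqP; rewrite /Z; field.
    by rewrite gt_eqF.
  have : d ^+ 2 / D ^+ 2 <= lam ^+ 2 / D ^+ 2 + Z.
    rewrite ler_pdivrMr ?exprn_gt0 // mulrDl divfK ?gt_eqF ?exprn_gt0 //.
    by rewrite [Z * _]mulrC.
  by rewrite !expr_div_n; lra.
set u := #|S|%:R : R in cS main deva devb *.
set dl := 1 - (d / D) ^+ 2 + (lam / D) ^+ 2 in Heta Zd.
have u0 := ltW cS.
have eta1 : 0 <= 1 + eta^-1 by rewrite addr_ge0 // invr_ge0 ltW.
have e1 : (\sum_(i in S) a i) ^+ 2 + (\sum_(i in S) b i) ^+ 2 <=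
    (1 + eta) * (u * (u / N%:R)) + (1 + eta^-1) * (u * dl).
  apply: le_trans (lerD deva devb) _.
  apply: le_trans (_ : (1 + eta) * (u * (u / N%:R) * Z) + (1 + eta^-1) * (u * (1 - Z)) <= _).
    rewrite le_eqVlt; apply/orP; left; apply/eqP; rewrite /Z (_ : \sum_i b i ^+ 2 = 1 - \sum_i a i ^+ 2); last by rewrite -ab addrC addKr.
    field.
    by rewrite ?gt_eqF.
  apply: lerD.
    rewrite ler_wpM2l ?addr_ge0 ?(ltW eta0) // -[leRHS]mulr1.
    by rewrite ler_wpM2l // mulr_ge0 // divr_ge0 // ltW.
  by rewrite ler_wpM2l // ler_wpM2l.
apply: le_trans main _.
apply: le_trans (_ : D ^+ 2 * (u * (lam / D) ^+ 2 +
    ((1 + eta) * (u * (u / N%:R)) + (1 + eta^-1) * (u * dl))) <= _).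
  rewrite [leRHS]mulrDr; apply: lerD; last by rewrite ler_wpM2l ?sqr_ge0.
  rewrite le_eqVlt; apply/orP; left; apply/eqP; field.
  by rewrite gt_eqF.
rewrite ler_wpM2l ?sqr_ge0 //.
have := ler_wpM2l u0 Heta; lra.
Qed.

End SpectralGraph.
(** * One round *)

Definition pushes (P : protocol) : bool := if P is Pull then false else true.
Definition pulls (P : protocol) : bool := if P is Push then false else true.

Section Round.
Variables (R : realType) (T : finType) (e : rel T) (q : R).
Hypothesis q01 : 0 < q <= 1.

Definition cell_w (u : T) (x : T * bool) : R :=
  choice_w R e u x.1 * (if x.2 then q else 1 - q).

Definition expect (f : config T -> R) : R := \sum_c config_w e q c * f c.

(** Transition operator of the chain of informed sets; [sum_state] identifies its k-th iterate with
    the expectation after k rounds. *)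
Definition markov (P : protocol) (f : {set T} -> R) (I : {set T}) : R :=
  expect (fun c => f (step P I c)).

Lemma choice_w_ge0 u w : 0 <= choice_w R e u w.
Proof. by rewrite /choice_w; case: ifP => _; rewrite ?divr_ge0 ?ler0n. Qed.

Lemma sum_choice_w u : \sum_w choice_w R e u w = 1.
Proof.
rewrite /choice_w; case: eqP => [_|/eqP d0].
  rewrite (bigD1 u) //= eqxx big1 ?addr0 // => w /negbTE ->; by [].
by rewrite -mulr_suml -degE divff // pnatr_eq0.
Qed.

Lemma cell_w_ge0 u x : 0 <= cell_w u x.
Proof.
case/andP: q01 => q0 q1; rewrite mulr_ge0 ?choice_w_ge0 //.
by case: ifP; rewrite ?subr_ge0 // ltW.
Qed.

Lemma sum_cell_w u : \sum_x cell_w u x = 1.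
Proof.
rewrite -(pair_bigA _ (fun w b => cell_w u (w, b))) /= -(sum_choice_w u).
by apply: eq_bigr => w _; rewrite big_bool /cell_w /=; ring.
Qed.

Lemma config_w_ge0 c : 0 <= config_w e q c.
Proof. by apply: prodr_ge0 => u _; exact: cell_w_ge0. Qed.

Lemma expect_prod (F : T -> T * bool -> R) :
  expect (fun c => \prod_u F u (c u)) = \prod_u \sum_x cell_w u x * F u x.
Proof.
rewrite bigA_distr_bigA /expect; apply: eq_bigr => c _.
by rewrite -big_split.
Qed.

Lemma expect_cst (a : R) : expect (fun=> a) = a.
Proof.
rewrite /expect -mulr_suml -[RHS]mul1r; congr (_ * _).
have <- : \prod_(u : T) (1 : R) = 1 by rewrite big1.
under [RHS]eq_bigr => u _ do rewrite -(sum_cell_w u).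
by rewrite bigA_distr_bigA.
Qed.

Lemma eq_expect f g : f =1 g -> expect f = expect g.
Proof. by move=> fg; apply: eq_bigr => c _; rewrite fg. Qed.

Lemma expectD f g : expect (fun c => f c + g c) = expect f + expect g.
Proof. by rewrite /expect -big_split; apply: eq_bigr => c _; rewrite mulrDr. Qed.

Lemma expectZ a f : expect (fun c => a * f c) = a * expect f.
Proof. by rewrite /expect mulr_sumr; apply: eq_bigr => c _; rewrite mulrCA. Qed.

Lemma expect_sum (I : finType) (Q : pred I) (f : I -> config T -> R) :
  expect (fun c => \sum_(i | Q i) f i c) = \sum_(i | Q i) expect (f i).
Proof. by rewrite /expect exchange_big; apply: eq_bigr => c _; rewrite mulr_sumr. Qed.

Lemma ler_expect f g : (forall c, f c <= g c) -> expect f <= expect g.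
Proof. by move=> fg; apply: ler_sum => c _; rewrite ler_wpM2l ?config_w_ge0. Qed.

(* From 1/y = 2/a - y/a^2 + (y - a)^2/(a^2 y); the variance bound makes 1/|I| and 1/(K + |U|) almost exact
   supermartingales, so no round-by-round concentration is needed. *)
Lemma expect_inv_le (Y : config T -> R) (l : R) (a := expect Y) :
  0 < l -> (forall c, l <= Y c) ->
  expect (fun c => (Y c)^-1) <=
  a^-1 + expect (fun c => (Y c - a) ^+ 2) / (a ^+ 2 * l).
Proof.
move=> l0 lY.
have a0 : 0 < a.
  by apply: lt_le_trans l0 _; rewrite -(expect_cst l); exact: ler_expect.
apply: le_trans (_ : expect (fun c => (2 * a^-1 + (- a ^- 2) * Y c) +
    (a ^+ 2 * l)^-1 * (Y c - a) ^+ 2) <= _).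
  apply: ler_expect => c; have y0 := lt_le_trans l0 (lY c).
  have -> : (Y c)^-1 = 2 * a^-1 + (- a ^- 2) * Y c +
      (a ^+ 2 * Y c)^-1 * (Y c - a) ^+ 2.
    by field; rewrite !gt_eqF.
  rewrite lerD2l ler_wpM2r ?sqr_ge0 // lef_pV2 ?posrE ?mulr_gt0 ?exprn_gt0 //.
  by rewrite ler_wpM2l ?sqr_ge0.
rewrite !expectD expect_cst !expectZ -/a.
rewrite le_eqVlt; apply/orP; left; apply/eqP; field.
by rewrite !gt_eqF.
Qed.

Section Step.
Variables (P : protocol) (I : {set T}).

(* When u chooses z and the transmission succeeds, w gets informed by that message. *)
Definition hits (w u z : T) : bool :=
  [&& pushes P, u \in I & z == w] || [&& pulls P, u == w & z \in I].

Definition hit_w (w u : T) : R := \sum_(z | hits w u z) choice_w R e u z.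

Definition miss_w (w : T) : R := \prod_u (1 - q * hit_w w u).

Definition missed (w : T) (c : config T) : R := (w \notin step P I c)%:R.

Lemma missedE w c : w \notin I ->
  missed w c = \prod_u (~~ (hits w u (c u).1 && (c u).2))%:R.
Proof.
move=> wI; rewrite /missed.
have -> : (w \in step P I c) = [exists u, hits w u (c u).1 && (c u).2].
  apply/idP/existsP.
    have pu : [exists u, [&& u \in I, (c u).1 == w & (c u).2]] ->
        exists u, [&& u \in I, (c u).1 == w & (c u).2] by move/existsP.
    have wE x : hits w x (c x).1 && (c x).2 -> exists x : T, hits w x (c x).1 && (c x).2.
      by exists x.
    rewrite /hits in wE *; rewrite /step; case: (P) wE => /= wE; rewrite !inE (negbTE wI) /=.
    - by move/pu => [u /and3P[uI uw cu]]; apply: (wE u); rewrite uI uw cu.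
    - by move/andP => [cI cw]; apply: (wE w); rewrite eqxx cI cw ?orbT.
    - case/orP => [/pu[u /and3P[uI uw cu]]|/andP[cI cw]].
        by apply: (wE u); rewrite uI uw cu.
      by apply: (wE w); rewrite eqxx cI cw ?orbT.
  rewrite /hits; case=> u /andP[/orP[/and3P[pP uI uw]|/and3P[pP /eqP uw cI]] cu].
    have pu : [exists u, [&& u \in I, (c u).1 == w & (c u).2]].
      by apply/existsP; exists u; rewrite uI uw cu.
    by rewrite /step; case: (P) pP => // _; rewrite !inE pu ?orbT.
  by rewrite /step -uw; case: (P) pP => // _; rewrite !inE cI cu ?orbT.
rewrite negb_exists; case: forallP => [h|h].
  by rewrite big1 // => u _; rewrite h.
symmetry; apply/eqP; rewrite prodf_seq_eq0; apply/hasP.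
case: (boolP [forall u, ~~ (hits w u (c u).1 && (c u).2)]) => [/forallP//|].
rewrite negb_forall => /existsP[u hu]; exists u; first exact: mem_index_enum.
by rewrite (negbTE hu) /=.
Qed.

Lemma expect_cell u (A : pred T) :
  \sum_x cell_w u x * (~~ (A x.1 && x.2))%:R = 1 - q * \sum_(z | A z) choice_w R e u z.
Proof.
rewrite -(pair_bigA _ (fun w b => cell_w u (w, b) * (~~ (A w && b))%:R)) /=.
rewrite -[X in _ = X - _](sum_choice_w u) mulr_sumr [X in _ - X]big_mkcond -sumrB.
apply: eq_bigr => w _; rewrite big_bool /cell_w /= andbT andbF /=.
by case: (A w); rewrite /= ?mulr0 ?mulr1; ring.
Qed.

Lemma expect_missed w : w \notin I -> expect (missed w) = miss_w w.
Proof.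
move=> wI; under eq_expect do rewrite missedE //.
rewrite (expect_prod (fun u x => (~~ (hits w u x.1 && x.2))%:R)).
by apply: eq_bigr => u _; rewrite (expect_cell u (hits w u)).
Qed.

Lemma hit_w_ge0 w u : 0 <= hit_w w u.
Proof. by apply: sumr_ge0 => z _; exact: choice_w_ge0. Qed.

Lemma hit_w_le1 w u : hit_w w u <= 1.
Proof.
rewrite -(sum_choice_w u) [leRHS](bigID (hits w u)) /= lerDl.
by apply: sumr_ge0 => z _; exact: choice_w_ge0.
Qed.

Lemma miss_cell_itv w u : 0 <= 1 - q * hit_w w u <= 1.
Proof.
case/andP: q01 => q0 q1; rewrite subr_ge0 gerBl mulr_ge0 ?hit_w_ge0 ?(ltW q0) // andbT.
by rewrite mulr_ile1 ?hit_w_ge0 ?hit_w_le1 ?(ltW q0).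
Qed.

Lemma miss_w_itv w : 0 <= miss_w w <= 1.
Proof.
apply/andP; split; first by apply: prodr_ge0 => u _; case/andP: (miss_cell_itv w u).
by apply: prodr_ile1 => u _; exact: miss_cell_itv.
Qed.

(* Negative correlation: for each u, the choices of u that inform w and those that inform w' are disjoint. *)
Lemma expect_missed2 w w' : w \notin I -> w' \notin I -> w != w' ->
  expect (fun c => missed w c * missed w' c) <= miss_w w * miss_w w'.
Proof.
move=> wI wI' ww'; under eq_expect do rewrite !missedE // -big_split /=.
rewrite (expect_prod (fun u x => (~~ (hits w u x.1 && x.2))%:R * (~~ (hits w' u x.1 && x.2))%:R)).
rewrite -big_split /=; apply: ler_prod => u _.
apply/andP; split.
  apply: sumr_ge0 => x _; apply: mulr_ge0; first exact: cell_w_ge0.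
  by rewrite mulr_ge0 ?ler0n.
have -> : \sum_x cell_w u x * ((~~ (hits w u x.1 && x.2))%:R * (~~ (hits w' u x.1 && x.2))%:R) =
    1 - q * (hit_w w u + hit_w w' u).
  transitivity (1 - q * \sum_(z | hits w u z || hits w' u z) choice_w R e u z).
    rewrite -(expect_cell u (fun z => hits w u z || hits w' u z)).
    apply: eq_bigr => x _; rewrite -natrM mulnb -negb_or andb_orl //.
  congr (1 - q * _); rewrite (bigID (hits w u)) /=; congr (_ + _).
    by apply: eq_bigl => z; case: (hits w u z); rewrite ?andbF ?orbT.
  apply: eq_bigl => z; rewrite andb_orl andbN /=.
  apply/andb_idr; rewrite /hits => /orP[/and3P[-> uI /eqP ->]|/and3P[-> /eqP -> zI]].
    rewrite uI eq_sym (negbTE ww') /= (_ : (u == w) = false) ?andbF //.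
    by apply: contraNF wI => /eqP <-.
  by rewrite (negbTE wI') /= eq_sym (negbTE ww') andbF.
case/andP: (miss_cell_itv w u) => h0 h1; case/andP: (miss_cell_itv w' u) => h0' h1'.
case/andP: q01 => q0 q1.
have hh : 0 <= q * hit_w w u * (q * hit_w w' u).
  by rewrite !mulr_ge0 ?hit_w_ge0 ?(ltW q0).
lra.
Qed.

Definition mean_missed : R := \sum_(w in ~: I) miss_w w.

Lemma step_sub c : I \subset step P I c.
Proof. by rewrite /step; case: (P); rewrite -?finset.setUA finset.subsetUl. Qed.

Lemma card_missed c : #|~: step P I c|%:R = \sum_(w in ~: I) missed w c.
Proof.
rewrite -sum1_card natr_sum big_mkcond [RHS]big_mkcond; apply: eq_bigr => w _.
rewrite !inE /missed; case: (boolP (w \in I)) => [wI|_] /=; last by case: ifP.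
by rewrite (fintype.subsetP (step_sub c)).
Qed.

Lemma expect_card_missed : expect (fun c => #|~: step P I c|%:R) = mean_missed.
Proof.
under eq_expect do rewrite card_missed.
rewrite expect_sum; apply: eq_bigr => w; rewrite inE => wI; exact: expect_missed.
Qed.

(** Negative correlation leaves only the diagonal terms p - p^2 with p = [miss_w w], each at most p
    and at most 1 - p. *)
Lemma var_card_missed
    (V := expect (fun c => (#|~: step P I c|%:R - mean_missed) ^+ 2)) :
  V <= mean_missed /\ V <= #|~: I|%:R - mean_missed.
Proof.
pose m := mean_missed.
have : V <= \sum_(w in ~: I) (miss_w w - miss_w w ^+ 2).
  have -> : V = expect (fun c => #|~: step P I c|%:R ^+ 2) - m ^+ 2.
    rewrite /V -/m; transitivity (expect (fun c => #|~: step P I c|%:R ^+ 2 +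
      ((- (2 * m)) * #|~: step P I c|%:R + m ^+ 2))).
      by apply: eq_expect => c; ring.
    by rewrite !expectD expectZ expect_card_missed expect_cst -/m; ring.
  rewrite lerBlDr sumrB.
  under eq_expect do rewrite card_missed expr2 mulr_suml.
  rewrite expect_sum expr2 {1}/m /mean_missed mulr_suml -sumrB -big_split /=.
  apply: ler_sum => w; rewrite inE => wI.
  under eq_expect do rewrite mulr_sumr.
  rewrite expect_sum mulr_sumr (bigD1 w) ?inE //= [X in _ <= _ + X](bigD1 w) ?inE //=.
  have -> : expect (fun c => missed w c * missed w c) = miss_w w.
    rewrite -expect_missed //; apply: eq_expect => c.
    by rewrite /missed -natrM mulnb andbb.
  rewrite -[X in _ <= _ - X + _]/(_ * _) addrA subrK lerD2l.
  apply: ler_sum => w'; rewrite inE => /andP[w'I w'w].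
  by apply: expect_missed2 => //; rewrite eq_sym.
move=> VS; split; apply: (le_trans VS).
  by rewrite ler_sum // => w _; rewrite gerBl sqr_ge0.
rewrite -sum1_card natr_sum -sumrB; apply: ler_sum => w _.
by case/andP: (miss_w_itv w) => h0 h1; nra.
Qed.

End Step.

End Round.

(** * Bounds on the mean number of uninformed vertices after one round *)

Section OneStepMean.
Variables (R : realType) (T : finType) (e : rel T) (q d D : R).
Hypothesis q01 : 0 < q <= 1.
Hypothesis symE : symmetric e.
Hypothesis d0 : 0 < d.
Hypothesis D0 : 0 < D.
Hypothesis degd : forall u, d <= (deg e u)%:R <= D.
Variables (P : protocol).
Local Notation nbrs := (nbrs R e).
Local Notation miss_w := (miss_w e q P).
Local Notation mean_missed := (mean_missed e q P).
Let cp : R := (pushes P)%:R.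
Let cq : R := (pulls P)%:R.

Definition growth_rate : R := q * (cp + cq).
(** Limit probability that a vertex with only informed neighbours stays uninformed: about D pushes
    reach it with probability about q / D each, and its own pull fails with probability 1 - q. *)
Definition decay_rate : R := expR (- (q * cp)) * (1 - q * cq).

Lemma deg_gt0 u : 0 < (deg e u)%:R :> R.
Proof. by case/andP: (degd u) => h _; exact: lt_le_trans h. Qed.

Lemma choice_wE u w : choice_w R e u w = (e u w)%:R / (deg e u)%:R.
Proof. by rewrite /choice_w -[_ == 0%N](@pnatr_eq0 R) gt_eqF ?deg_gt0. Qed.

Lemma sum_choice_nbrs (I : {set T}) w :
  \sum_(z in I) choice_w R e w z = nbrs I w / (deg e w)%:R.
Proof.
rewrite /nbrs mulr_suml; apply: eq_bigr => z _.
by rewrite choice_wE symE.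
Qed.

Lemma miss_wE (I : {set T}) w : w \notin I ->
  miss_w I w = (1 - q * (cq * (nbrs I w / (deg e w)%:R))) *
     \prod_(u in I) (1 - q * (cp * ((e u w)%:R / (deg e u)%:R))).
Proof.
move=> wI; rewrite /miss_w (bigD1 w) //=; congr (_ * _).
  rewrite -sum_choice_nbrs /hit_w (eq_bigl (fun z => pulls P && (z \in I))); last first.
    by move=> z; rewrite /hits (negbTE wI) andbF /= eqxx.
  rewrite /cq; case: (pulls P) => /=; last by rewrite big_pred0 // mul0r.
  by rewrite mul1r.
rewrite [RHS]big_mkcond [LHS]big_mkcond; apply: eq_bigr => u _.
case: eqP => [->|/eqP uw] /=; first by rewrite (negbTE wI).
rewrite /hit_w (eq_bigl (fun z => [&& pushes P, u \in I & z == w])); last first.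
  by move=> z; rewrite /hits (negbTE uw) /= andbF orbF.
rewrite /cp; case: (u \in I); last first.
  by rewrite big_pred0 ?mulr0 ?subr0 // => z; rewrite andbF.
case: (pushes P) => /=; last first.
  by rewrite big_pred0 // !mul0r mulr0.
by rewrite big_pred1_eq choice_wE mul1r.
Qed.

Let q0 : 0 < q. Proof. by case/andP: q01. Qed.
Let q1 : q <= 1. Proof. by case/andP: q01. Qed.
Let cp01 : 0 <= cp <= 1. Proof. by rewrite /cp; case: (pushes P); rewrite ?lexx ?ler01. Qed.
Let cq01 : 0 <= cq <= 1. Proof. by rewrite /cq; case: (pulls P); rewrite ?lexx ?ler01. Qed.

Lemma mulr_itv01 (a b : R) : 0 <= a <= 1 -> 0 <= b <= 1 -> 0 <= a * b <= 1.
Proof. by case/andP => a0 a1 /andP[b0 b1]; rewrite mulr_ge0 ?mulr_ile1. Qed.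

Lemma natb_itv (b : bool) : 0 <= (b%:R : R) <= 1.
Proof. by case: b; rewrite ?lexx ?ler01. Qed.

Lemma onem_itv01 (a : R) : 0 <= a <= 1 -> 0 <= 1 - a <= 1.
Proof. by case/andP => a0 a1; rewrite subr_ge0 a1 gerBl. Qed.

Let q01' : 0 <= q <= 1. Proof. by rewrite ltW. Qed.

Lemma nbrsD_itv (I : {set T}) w : 0 <= nbrs I w / D <= 1.
Proof.
rewrite divr_ge0 ?nbrs_ge0 ?(ltW D0) //= ler_pdivrMr // mul1r.
by apply: le_trans (nbrs_le_deg R symE I w) _; case/andP: (degd w).
Qed.

Lemma nbrs_deg_itv (I : {set T}) w : 0 <= nbrs I w / (deg e w)%:R <= 1.
Proof.
by rewrite divr_ge0 ?nbrs_ge0 //= ler_pdivrMr ?deg_gt0 // mul1r nbrs_le_deg.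
Qed.

Lemma edge_deg_itv u w : 0 <= ((e u w)%:R / (deg e u)%:R : R) <= 1.
Proof.
rewrite divr_ge0 ?ler0n //= ler_pdivrMr ?deg_gt0 // mul1r degE (bigD1 w) //= lerDl.
by apply: sumr_ge0 => z _; rewrite ler0n.
Qed.

Let pull_itv (I : {set T}) w : 0 <= q * (cq * (nbrs I w / (deg e w)%:R)) <= 1.
Proof. exact: mulr_itv01 q01' (mulr_itv01 cq01 (nbrs_deg_itv I w)). Qed.

Let push_itv u w : 0 <= q * (cp * ((e u w)%:R / (deg e u)%:R)) <= 1.
Proof. exact: mulr_itv01 q01' (mulr_itv01 cp01 (edge_deg_itv u w)). Qed.

Lemma miss_w_le (I : {set T}) w : w \notin I ->
  miss_w I w <= expR (- (q * cp * (nbrs I w / D))) * (1 - q * cq * (nbrs I w / D)).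
Proof.
move=> wI; rewrite miss_wE // mulrC.
have inv_deg u : D^-1 <= (deg e u)%:R^-1.
  by rewrite lef_pV2 ?posrE ?deg_gt0 //; case/andP: (degd u).
have n0 := nbrs_ge0 R e I w.
have /andP[qcp0 _] : 0 <= q * cp <= 1 by rewrite mulr_itv01.
have /andP[qcq0 _] : 0 <= q * cq <= 1 by rewrite mulr_itv01.
apply: ler_pM.
- by apply: prodr_ge0 => u _; case/andP: (onem_itv01 (push_itv u w)).
- by case/andP: (onem_itv01 (pull_itv I w)).
- rewrite {1}/nbrs mulr_suml mulr_sumr -sumrN expR_sum; apply: ler_prod => u _.
  case/andP: (onem_itv01 (push_itv u w)) => -> _ /=.
  apply: le_trans (expR_ge1Dx _); rewrite lerD2l lerN2 [leRHS]mulrA.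
  by rewrite ler_wpM2l // ler_wpM2l ?ler0n.
- by rewrite lerD2l lerN2 [leRHS]mulrA ler_wpM2l // ler_wpM2l.
Qed.

Lemma prod1B_ge (I : finType) (Q : pred I) (a : I -> R) :
  (forall i, Q i -> 0 <= a i <= 1) ->
  1 - \sum_(i | Q i) a i <= \prod_(i | Q i) (1 - a i).
Proof.
move=> a01.
(* The upper bound 1 is carried along because the induction step for the lower bound uses it. *)
have : 1 - \sum_(i | Q i) a i <= \prod_(i | Q i) (1 - a i) <= 1.
  elim/big_rec2: _ => [|i x y Qi /andP[h1 h2]]; first by rewrite subr0 lexx.
  have /andP[b0 b1] := a01 i Qi; apply/andP; split; last by nra.
  by nra.
by case/andP.
Qed.

(** Union bound over the pull of [w] and the pushes of its informed neighbours. *)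
Lemma miss_w_ge (I : {set T}) w : w \notin I ->
  1 - growth_rate * (nbrs I w / d) <= miss_w I w.
Proof.
move=> wI; rewrite miss_wE //.
have inv_deg u : (deg e u)%:R^-1 <= d^-1.
  by rewrite lef_pV2 ?posrE ?deg_gt0 //; case/andP: (degd u).
have /andP[qcp0 _] : 0 <= q * cp <= 1 by rewrite mulr_itv01.
have /andP[qcq0 _] : 0 <= q * cq <= 1 by rewrite mulr_itv01.
have n0 := nbrs_ge0 R e I w.
have hA : q * (cq * (nbrs I w / (deg e w)%:R)) <= q * cq * (nbrs I w / d).
  by rewrite mulrA ler_wpM2l // ler_wpM2l.
have hB : \sum_(u in I) q * (cp * ((e u w)%:R / (deg e u)%:R)) <= q * cp * (nbrs I w / d).
  rewrite /nbrs mulr_suml mulr_sumr; apply: ler_sum => u _.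
  by rewrite mulrA ler_wpM2l // ler_wpM2l ?ler0n.
have hP := prod1B_ge (fun u (_ : u \in I) => push_itv u w).
have hP1 : \prod_(u in I) (1 - q * (cp * ((e u w)%:R / (deg e u)%:R))) <= 1.
  by apply: prodr_ile1 => u _; exact: onem_itv01.
case/andP: (pull_itv I w) => a0 a1.
rewrite /growth_rate mulrDr mulrDl.
move: hA hB hP hP1 a0 a1.
set A := q * (cq * _); set B := \sum_(u in I) _; set p := \prod_(u in I) _.
set x := q * cp * _; set y := q * cq * _ => hA hB hP hP1 a0 a1.
have : A * p <= A by rewrite ler_piMr.
by rewrite mulrBl mul1r; lra.
Qed.

(** With t = q c / (d - q), where c is [cp] on edges and 0 elsewhere, each push factor is at least 1
    - t / (1 + t) = 1 / (1 + t) >= e^(-t). The exponent q D / (d - q) approaches q as the degrees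
    grow and D / d tends to 1. *)
Lemma miss_w_ge_decay (I : {set T}) w : q < d -> w \notin I ->
  expR (- (cp * (q * D / (d - q)))) * (1 - q * cq) <= miss_w I w.
Proof.
move=> qd wI; rewrite miss_wE // mulrC.
have dq : 0 < d - q by rewrite subr_gt0.
have [cp0 cp1] := andP cp01; have [cq0 cq1] := andP cq01.
have qcq01 : 0 <= q * cq <= 1 by rewrite mulr_itv01.
have /andP[qcq0 _] := qcq01.
apply: ler_pM; rewrite ?expR_ge0 //.
- by case/andP: (onem_itv01 qcq01).
- rewrite lerD2l lerN2 mulrA ler_piMr //.
  by case/andP: (nbrs_deg_itv I w).
apply: le_trans (_ : expR (- (cp * (q * nbrs I w / (d - q)))) <= _).
  rewrite ler_expR lerN2 ler_wpM2l // ler_wpM2r ?invr_ge0 ?(ltW dq) //.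
  rewrite ler_wpM2l ?(ltW q0) //.
  by apply: le_trans (nbrs_le_deg R symE I w) _; case/andP: (degd w).
rewrite /nbrs mulr_sumr mulr_suml mulr_sumr -sumrN expR_sum.
apply: ler_prod => u _; rewrite expR_ge0 /=.
set c := cp * (e u w)%:R.
have /andP[c0 c1] : 0 <= c <= 1 by rewrite mulr_itv01 ?natb_itv.
have -> : cp * (q * (e u w)%:R / (d - q)) = q * c / (d - q) by rewrite /c; ring.
have -> : q * (cp * ((e u w)%:R / (deg e u)%:R)) = q * c / (deg e u)%:R by rewrite /c; ring.
have qc0 : 0 <= q * c by rewrite mulr_ge0 ?(ltW q0).
have t0 : 0 <= q * c / (d - q) by rewrite divr_ge0 // ltW.
apply: le_trans (_ : (1 + q * c / (d - q))^-1 <= _).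
  rewrite expRN lef_pV2 ?posrE ?expR_gt0 ?expR_ge1Dx //.
  by rewrite ltr_wpDr.
have dqc : 0 < d - q + q * c by apply: ltr_wpDr.
have -> : (1 + q * c / (d - q))^-1 = 1 - q * c / (d - q + q * c).
  by field; rewrite !gt_eqF.
rewrite lerD2l lerN2 ler_wpM2l // lef_pV2 ?posrE ?deg_gt0 //.
have /andP[dd _] := degd u.
have : q * c <= q by rewrite ler_piMr // ltW.
lra.
Qed.

(* On an expander this holds with th^2 close to |S|/n: the neighbourhoods of S overlap as little as in
   a random set, which bounds both the edges inside S and the number of wasted messages. *)
Definition spread (S : {set T}) (th : R) : Prop :=
  \sum_w nbrs S w ^+ 2 <= D ^+ 2 * (#|S|%:R * th ^+ 2).

(** AM-GM in the form x <= x^2 / (2 th D) + th D / 2, balanced at the value x = th D that [spread]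
    allows on average. *)
Lemma spread_inner (S : {set T}) th : 0 < th -> spread S th ->
  \sum_(w in S) nbrs S w <= D * (#|S|%:R * th).
Proof.
move=> th0 spS; have thD : 0 < th * D by rewrite mulr_gt0.
apply: le_trans (_ : \sum_(w in S) ((2 * (th * D))^-1 * nbrs S w ^+ 2 + th * D / 2) <= _).
  apply: ler_sum => w _; set x := nbrs S w.
  rewrite -subr_ge0.
  have -> : (2 * (th * D))^-1 * x ^+ 2 + th * D / 2 - x =
    (2 * (th * D))^-1 * (x - th * D) ^+ 2 by field; rewrite !gt_eqF.
  by rewrite mulr_ge0 ?sqr_ge0 // invr_ge0 mulr_ge0 // ltW.
rewrite big_split /= sumr_const -mulr_sumr.
apply: le_trans (_ : (2 * (th * D))^-1 * (D ^+ 2 * (#|S|%:R * th ^+ 2)) + th * D / 2 *+ #|S| <= _).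
  rewrite lerD2r ler_wpM2l //; first by rewrite invr_ge0 mulr_ge0 // ltW.
  apply: le_trans spS; rewrite [leRHS](bigID (mem S)) /= lerDl.
  by apply: sumr_ge0 => w _; rewrite sqr_ge0.
rewrite -[_ *+ #|S|]mulr_natl le_eqVlt; apply/orP; left; apply/eqP; field.
by rewrite !gt_eqF.
Qed.

Lemma cutE (S : {set T}) :
  \sum_(w in ~: S) nbrs S w = \sum_(w in S) ((deg e w)%:R - nbrs S w).
Proof.
rewrite sum_nbrs_sym //; apply: eq_bigr => w _.
by rewrite -(nbrsC R symE S w) [_ + nbrs _ _]addrC addrK.
Qed.

Lemma cut_ge (S : {set T}) th : 0 < th -> spread S th ->
  #|S|%:R * (d - D * th) <= \sum_(w in ~: S) nbrs S w.
Proof.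
move=> th0 spS; rewrite cutE sumrB mulrBr; apply: lerB.
  rewrite mulr_natl -sumr_const; apply: ler_sum => w _.
  by case/andP: (degd w).
by apply: le_trans (spread_inner th0 spS) _; rewrite mulrCA.
Qed.

Lemma cut_le (S : {set T}) : \sum_(w in ~: S) nbrs S w <= #|S|%:R * D.
Proof.
rewrite cutE mulr_natl -sumr_const; apply: ler_sum => w _.
by have /andP[_ h] := degd w; rewrite lerBlDr (le_trans h) // lerDl nbrs_ge0.
Qed.

Let cpq1 : 1 <= cp + cq.
Proof. by rewrite /cp /cq; case: (P); rewrite /= ?addr0 ?add0r // lerDl. Qed.

Lemma expRN_le (y : R) : 0 <= y -> expR (- y) <= 1 - y + y ^+ 2.
Proof.
move=> y0; apply: le_trans (_ : (1 + y)^-1 <= _).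
  by rewrite expRN lef_pV2 ?posrE ?expR_gt0 ?expR_ge1Dx // ltr_wpDr.
rewrite -div1r ler_pdivrMr ?ltr_wpDr //.
have y3 : 0 <= y ^+ 3 by rewrite exprn_ge0.
by nra.
Qed.

(** Second-order expansion of the miss probability in y = q [nbrs] / D: the edge boundary of I
    controls the linear term, [spread] the quadratic one. *)
Lemma mean_missed_le_growth (I : {set T}) th : 0 < th -> spread I th ->
  mean_missed I <= #|~: I|%:R - #|I|%:R * (growth_rate * (d / D - th) - 2 * th ^+ 2).
Proof.
move=> th0 spI.
pose y w := q * (nbrs I w / D).
apply: le_trans (_ : \sum_(w in ~: I) (1 - (cp + cq) * y w + 2 * y w ^+ 2) <= _).
  apply: ler_sum => w; rewrite inE => wI; apply: le_trans (miss_w_le wI) _.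
  rewrite (_ : q * cp * _ = cp * y w); last by rewrite /y; ring.
  rewrite (_ : q * cq * _ = cq * y w); last by rewrite /y; ring.
  have /andP[y0 y1] : 0 <= y w <= 1 by rewrite mulr_itv01 ?nbrsD_itv.
  have h := expRN_le y0.
  (* The coefficient 2 of y^2 serves all protocols; it is attained for [PushPull], where (1 - y +
     y^2)(1 - y) = 1 - 2 y + 2 y^2 - y^3. *)
  rewrite /cp /cq; case: (P) => /=; rewrite ?mul0r ?mul1r ?subr0 ?mulr1 ?addr0 ?add0r ?oppr0 ?expR0.
  - by rewrite mul1r; nra.
  - by nra.
  - have : expR (- y w) * (1 - y w) <= (1 - y w + y w ^+ 2) * (1 - y w).
      by rewrite ler_wpM2r // subr_ge0.
    have : 0 <= y w ^+ 3 by rewrite exprn_ge0.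
    by nra.
rewrite big_split sumrB /= sumr_const -[X in _ - X]mulr_sumr -[X in _ + X]mulr_sumr /growth_rate.
have hy : #|I|%:R * (q * (d / D - th)) <= \sum_(w in ~: I) y w.
  rewrite -mulr_sumr -mulr_suml mulrCA ler_wpM2l ?(ltW q0) //.
  rewrite ler_pdivlMr //; apply: le_trans (cut_ge th0 spI).
  by rewrite -mulrA ler_wpM2l ?ler0n // mulrBl divfK ?gt_eqF // [th * D]mulrC.
have hy2 : \sum_(w in ~: I) y w ^+ 2 <= #|I|%:R * th ^+ 2.
  apply: le_trans (_ : (D ^+ 2)^-1 * \sum_w nbrs I w ^+ 2 <= _).
    rewrite mulr_sumr [leRHS](bigID (mem (~: I))) /= -[leLHS]addr0 lerD //; last first.
      by apply: sumr_ge0 => w _; rewrite mulr_ge0 ?sqr_ge0 // invr_ge0 sqr_ge0.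
    apply: ler_sum => w _; rewrite /y exprMn expr_div_n [_ / D ^+ 2]mulrC.
    by rewrite ler_piMl ?exprn_ile1 ?(ltW q0) // mulr_ge0 ?sqr_ge0 // invr_ge0 sqr_ge0.
  by rewrite mulrC ler_pdivrMr ?exprn_gt0 // [leRHS]mulrC.
have cpq0 : 0 <= cp + cq by apply: le_trans cpq1.
have := ler_wpM2l cpq0 hy.
have -> : (cp + cq) * (#|I|%:R * (q * (d / D - th))) = #|I|%:R * (q * (cp + cq) * (d / D - th)) by ring.
set X := \sum_(w in ~: I) y w; set Y := \sum_(w in ~: I) _ in hy2 *.
by rewrite mulrBr; lra.
Qed.

(** For x = [nbrs I w] / D the bound of [miss_w_le] exceeds its value [decay_rate] at x = 1 by at
    most 2 (1 - x), one 1 - x for each of the push and pull factors. The edge boundary of U makes 1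
    - x small on average over U. *)
Lemma mean_missed_le_decay (I : {set T}) th : 0 < th -> spread (~: I) th ->
  mean_missed I <= #|~: I|%:R * (decay_rate + 2 * (1 - d / D) + 2 * th).
Proof.
move=> th0 spU.
pose x w := nbrs I w / D.
apply: le_trans (_ : \sum_(w in ~: I) (decay_rate + 2 * (1 - x w)) <= _).
  apply: ler_sum => w; rewrite inE => wI; apply: le_trans (miss_w_le wI) _.
  rewrite -/(x w); have /andP[x0 x1] : 0 <= x w <= 1 := nbrsD_itv I w.
  have /andP[a0 a1] : 0 <= q * cp <= 1 by rewrite mulr_itv01.
  have /andP[b0 b1] : 0 <= q * cq <= 1 by rewrite mulr_itv01.
  rewrite /decay_rate; set a := q * cp in a0 a1 *; set b := q * cq in b0 b1 *.
  have e1 : expR (- (a * x w)) <= 1 by rewrite expR_le1 oppr_le0 mulr_ge0.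
  have e0 := expR_ge0 (- (a * x w)).
  have ed : expR (- (a * x w)) - expR (- a) <= 1 - x w.
    have -> : - a = - (a * x w) + - (a * (1 - x w)) by ring.
    rewrite expRD -[X in X - _]mulr1 -mulrBr.
    have h : 1 - expR (- (a * (1 - x w))) <= a * (1 - x w).
      by have := expR_ge1Dx (- (a * (1 - x w))); lra.
    have h0 : 0 <= 1 - x w by rewrite subr_ge0.
    have h1 : 0 <= 1 - expR (- (a * (1 - x w))).
      by rewrite subr_ge0 expR_le1 oppr_le0 mulr_ge0.
    apply: le_trans (_ : 1 - expR (- (a * (1 - x w))) <= _); first by rewrite ler_piMl.
    by apply: le_trans h _; rewrite ler_piMl.
  have bx : b * x w <= 1 by rewrite mulr_ile1.
  have h2 : (expR (- (a * x w)) - expR (- a)) * (1 - b) <= (1 - x w) * 1.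
    have [s|s] := leP 0 (expR (- (a * x w)) - expR (- a)).
      by rewrite ler_pM // ?subr_ge0 // gerBl.
    apply: le_trans (_ : 0 <= _); last by rewrite mulr1 subr_ge0.
    by rewrite nmulr_rle0 // subr_ge0.
  have h3 : expR (- (a * x w)) * (b * (1 - x w)) <= 1 * (1 * (1 - x w)).
    apply: ler_pM => //; first by rewrite mulr_ge0 // subr_ge0.
    by rewrite ler_wpM2r // subr_ge0.
  by lra.
rewrite big_split /= sumr_const -mulr_sumr sumrB sumr_const.
have hx : #|~: I|%:R * (d / D - th) <= \sum_(w in ~: I) x w.
  rewrite -mulr_suml sum_nbrs_sym // -{2}[I]finset.setCK ler_pdivlMr //.
  apply: le_trans (cut_ge th0 spU).
  by rewrite -mulrA ler_wpM2l ?ler0n // mulrBl divfK ?gt_eqF // [th * D]mulrC.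
rewrite -[decay_rate *+ _]mulr_natl.
set n := #|~: I|%:R in hx *; set X := \sum_(w in ~: I) x w in hx *.
lra.
Qed.

(** Every protocol satisfies miss <= 1 - y / 2 for y = q x in [0, 1]. This is crude, but gives a
    contraction whenever th stays below d / D, even for a large uninformed set. *)
Lemma mean_missed_le_contract (I : {set T}) th : 0 < th -> spread (~: I) th ->
  mean_missed I <= #|~: I|%:R * (1 - q / 2 * (d / D - th)).
Proof.
move=> th0 spU.
pose x w := nbrs I w / D.
apply: le_trans (_ : \sum_(w in ~: I) (1 - q / 2 * x w) <= _).
  apply: ler_sum => w; rewrite inE => wI; apply: le_trans (miss_w_le wI) _.
  rewrite -/(x w); have /andP[x0 x1] : 0 <= x w <= 1 := nbrsD_itv I w.
  have /andP[y0 y1] : 0 <= q * x w <= 1 by apply: mulr_itv01 => //; exact: nbrsD_itv.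
  have h : expR (- (q * x w)) <= 1 - q * x w / 2.
    apply: le_trans (_ : (1 + q * x w)^-1 <= _).
      by rewrite expRN lef_pV2 ?posrE ?expR_gt0 ?expR_ge1Dx // ltr_wpDr.
    by rewrite -div1r ler_pdivrMr ?ltr_wpDr //; nra.
  have e0 := expR_ge0 (- (q * x w)).
  rewrite /cp /cq; case: (P) => /=; rewrite ?mulr1 ?mulr0 ?mul0r ?oppr0 ?expR0 ?subr0 ?mulr1 ?mul1r.
  - by lra.
  - by lra.
  - apply: le_trans (_ : expR (- (q * x w)) <= _); last by lra.
    by rewrite ler_piMr // gerBl.
rewrite sumrB sumr_const -mulr_sumr.
have hx : #|~: I|%:R * (d / D - th) <= \sum_(w in ~: I) x w.
  rewrite -mulr_suml sum_nbrs_sym // -{2}[I]finset.setCK ler_pdivlMr //.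
  apply: le_trans (cut_ge th0 spU).
  by rewrite -mulrA ler_wpM2l ?ler0n // mulrBl divfK ?gt_eqF // [th * D]mulrC.
have q20 : 0 <= q / 2 by rewrite divr_ge0 // ltW.
have := ler_wpM2l q20 hx.
by set n := #|~: I|%:R; set X := \sum_(i in _) _; lra.
Qed.

Lemma growth_rate_ge0 : 0 <= growth_rate.
Proof. by rewrite /growth_rate mulr_ge0 ?addr_ge0 ?ler0n ?(ltW q0). Qed.

Lemma mean_missed_ge_growth (I : {set T}) :
  #|~: I|%:R - growth_rate * (D / d) * #|I|%:R <= mean_missed I.
Proof.
apply: le_trans (_ : \sum_(w in ~: I) (1 - growth_rate * (nbrs I w / d)) <= _); last first.
  by apply: ler_sum => w; rewrite inE; exact: miss_w_ge.
rewrite sumrB sumr_const lerD2l lerN2 -mulr_sumr -mulrA ler_wpM2l ?growth_rate_ge0 //.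
rewrite -mulr_suml mulrAC ler_wpM2r ?invr_ge0 ?(ltW d0) //.
by rewrite [D * _]mulrC cut_le.
Qed.

Lemma mean_missed_ge_decay (I : {set T}) : q < d ->
  #|~: I|%:R * (expR (- (cp * (q * D / (d - q)))) * (1 - q * cq)) <= mean_missed I.
Proof.
move=> qd; rewrite mulr_natl -sumr_const; apply: ler_sum => w; rewrite inE.
exact: miss_w_ge_decay.
Qed.

End OneStepMean.
(** * Iterated rounds *)

Section Chain.
Variables (R : realType) (T : finType) (e : rel T) (q : R).
Hypothesis q01 : 0 < q <= 1.
Variables (P : protocol).
Local Notation markov := (markov e q P).

Definition step_closed (A : pred {set T}) : Prop :=
  forall I c, A I -> A (step P I c).

Lemma step_closedT : step_closed xpredT.
Proof. by []. Qed.

Lemma ler_markov_on A f g : step_closed A -> (forall I, A I -> f I <= g I) ->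
  forall I, A I -> markov f I <= markov g I.
Proof. by move=> clA fg I AI; apply: ler_expect => // c; apply: fg; exact: clA. Qed.

Lemma ler_iter_markov_on A k f g : step_closed A -> (forall I, A I -> f I <= g I) ->
  forall I, A I -> iter k markov f I <= iter k markov g I.
Proof. by move=> clA fg; elim: k => //= k IH; exact: ler_markov_on. Qed.

Lemma iter_markovZ k a f : iter k markov (fun I => a * f I) =1 fun I => a * iter k markov f I.
Proof.
elim: k => //= k IH I; rewrite /markov -expectZ.
by apply: eq_expect => c; rewrite -IH.
Qed.

Lemma iter_markovDl k a f : iter k markov (fun I => a + f I) =1 fun I => a + iter k markov f I.
Proof.
elim: k => //= k IH I; rewrite /markov -[X in X + _](expect_cst e q a) -expectD.
by apply: eq_expect => c; rewrite -IH.
Qed.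

Lemma iter_markov_decay A k f kappa : step_closed A -> 0 <= kappa ->
  (forall I, A I -> markov f I <= kappa * f I) ->
  forall I, A I -> iter k markov f I <= kappa ^+ k * f I.
Proof.
move=> clA k0 fk; elim: k => [|k IH] I AI; first by rewrite expr0 mul1r.
rewrite iterSr; apply: le_trans (ler_iter_markov_on k clA fk AI) _.
rewrite iter_markovZ exprS -mulrA ler_wpM2l //; exact: IH.
Qed.

(** Replacing f by 0 on the absorbing set B makes the drift condition hold everywhere although it is
    only known outside B. Markov's inequality at level m then turns the decay of the mean into a
    bound on the probability of not having reached B. *)
Lemma phase_bound (A B : pred {set T}) k f kappa m :
  step_closed A -> step_closed B -> 0 <= kappa -> 0 < m ->
  (forall I, 0 <= f I) ->
  (forall I, A I -> ~~ B I -> markov f I <= kappa * f I) ->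
  (forall I, A I -> ~~ B I -> m <= f I) ->
  forall I, A I -> iter k markov (fun J => (~~ B J)%:R) I <= kappa ^+ k * f I / m.
Proof.
move=> clA clB k0 m0 f0 fk fm I AI.
pose g J := (~~ B J)%:R * f J.
have g0 J : 0 <= g J by rewrite /g mulr_ge0 ?ler0n.
apply: le_trans (_ : iter k markov (fun J => m^-1 * g J) I <= _).
  apply: (ler_iter_markov_on k clA) => // J AJ; rewrite /g.
  case: (boolP (B J)) => BJ /=; first by rewrite mul0r mulr0.
  by rewrite mul1r mulrC ler_pdivlMr // mul1r fm.
rewrite iter_markovZ mulrC ler_wpM2r ?invr_ge0 ?(ltW m0) //.
apply: le_trans (_ : kappa ^+ k * g I <= _); last first.
  rewrite ler_wpM2l ?exprn_ge0 // /g; case: (B I); rewrite /= ?mul0r ?mul1r //.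
apply: (iter_markov_decay k clA k0 _ AI) => J AJ; rewrite {2}/g.
case: (boolP (B J)) => BJ /=.
  rewrite mul0r mulr0 /markov -[leRHS](expect_cst e q); apply: ler_expect => // c.
  by rewrite /g clB // mul0r.
rewrite mul1r; apply: le_trans (fk J AJ BJ); apply: ler_expect => // c.
by rewrite /g; case: (B _); rewrite /= ?mul0r ?mul1r.
Qed.

(** Case split after k1 rounds: inside B the remaining rounds contribute at most eps, outside B at
    most 1. *)
Lemma iter_markov_compose (A B : pred {set T}) k1 k2 g (eps : R) :
  step_closed A -> 0 <= eps ->
  (forall I, A I -> B I -> iter k2 markov g I <= eps) ->
  (forall I, g I <= 1) ->
  forall I, A I -> iter (k1 + k2) markov g I <= eps + iter k1 markov (fun J => (~~ B J)%:R) I.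
Proof.
move=> clA eps0 geps g1 I AI; rewrite iterD -iter_markovDl.
apply: (ler_iter_markov_on k1 clA) => // J AJ.
case: (boolP (B J)) => BJ /=; first by rewrite addr0 geps.
apply: le_trans (_ : 1 <= _); last by rewrite lerDr.
have := @ler_iter_markov_on xpredT k2 g (fun=> 1) step_closedT (fun I _ => g1 I) J isT.
move/le_trans; apply; rewrite -[X in _ <= X]addr0.
elim: k2 {geps} J {AJ BJ} => [|k IH] J /=; first by rewrite addr0.
rewrite addr0 -[leRHS](expect_cst e q); apply: ler_expect => // c.
by have := IH (step P J c); rewrite addr0.
Qed.

Lemma step_closed_card m : step_closed (fun I : {set T} => (m <= #|I|)%N).
Proof. by move=> I c /leq_trans; apply; apply: subset_leq_card; exact: step_sub. Qed.

(* [state] reads the round i < t of a t-round outcome, so sums over outcomes are split off at the last round. *)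
Definition snoc t (om : {ffun 'I_t -> config T}) (c : config T) : {ffun 'I_t.+1 -> config T} :=
  [ffun i => if unlift ord_max i is Some j then om j else c].

Lemma snoc_lift t (om : {ffun 'I_t -> config T}) c j : snoc om c (lift ord_max j) = om j.
Proof. by rewrite ffunE liftK. Qed.

Lemma snoc_max t (om : {ffun 'I_t -> config T}) c : snoc om c ord_max = c.
Proof. by rewrite ffunE unlift_none. Qed.

Lemma sum_snoc t (F : {ffun 'I_t.+1 -> config T} -> R) :
  \sum_om F om = \sum_om \sum_c F (snoc om c).
Proof.
rewrite pair_big /= (reindex (fun p : {ffun 'I_t -> config T} * config T => snoc p.1 p.2)) //.
exists (fun om : {ffun 'I_t.+1 -> config T} => ([ffun j => om (lift ord_max j)], om ord_max)) => [[om c] _|om _] /=.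
  rewrite snoc_max; congr pair; apply/ffunP => j; rewrite ffunE snoc_lift //.
apply/ffunP => i; rewrite ffunE; case: unliftP => [j ->|->] //.
by rewrite ffunE.
Qed.

Lemma prod_snoc t (om : {ffun 'I_t -> config T}) c :
  \prod_(i < t.+1) config_w e q (snoc om c i) =
  (\prod_(i < t) config_w e q (om i)) * config_w e q c.
Proof.
rewrite big_ord_recr /= snoc_max; congr (_ * _); apply: eq_bigr => i _.
rewrite (_ : widen_ord _ i = lift ord_max i) ?snoc_lift //.
by apply: val_inj; rewrite /= /bump leqNgt ltn_ord.
Qed.

Lemma stateS v t (om : {ffun 'I_t -> config T}) k (kt : (k < t)%N) :
  state P v om k.+1 = step P (state P v om k) (om (Ordinal kt)).
Proof.
rewrite /=; case: insubP => [i _ ik|]; last by rewrite kt.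
by congr (step _ _ (om _)); exact: val_inj.
Qed.

Lemma state_snoc v t (om : {ffun 'I_t -> config T}) c k : (k <= t)%N ->
  state P v (snoc om c) k = state P v om k.
Proof.
elim: k => // k IH kt; have kt1 : (k < t.+1)%N := ltnW kt.
rewrite (stateS v (snoc om c) kt1).
rewrite (stateS v om kt).
rewrite (IH (ltnW kt)).
have -> : Ordinal kt1 = lift ord_max (Ordinal kt).
  by apply: val_inj; rewrite /= /bump leqNgt kt.
by rewrite snoc_lift.
Qed.

Lemma state_snoc_max v t (om : {ffun 'I_t -> config T}) c :
  state P v (snoc om c) t.+1 = step P (state P v om t) c.
Proof.
rewrite (stateS _ _ (ltnSn t)) state_snoc //; congr step.
by rewrite -[RHS](snoc_max om c); congr (snoc _ _ _); apply: val_inj.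
Qed.

(** Bridge from sums over outcomes of t rounds to the operator; rounds after the k-th one sum to
    1. *)
Lemma sum_state v t k f : (k <= t)%N ->
  \sum_(om : {ffun 'I_t -> config T}) (\prod_(i < t) config_w e q (om i)) * f (state P v om k) =
  iter k markov f [set v]%SET.
Proof.
elim: t k f => [|t IH] k f.
  rewrite leqn0 => /eqP ->; rewrite (bigD1 [ffun=> [ffun x => (x, true)]]) //= big_ord0 mul1r.
  rewrite big1 ?addr0 // => om; rewrite (_ : om = [ffun=> [ffun x => (x, true)]]) ?eqxx //.
  by apply/ffunP => -[].
rewrite leq_eqVlt sum_snoc => /predU1P[->|].
  under eq_bigr do under eq_bigr do rewrite prod_snoc state_snoc_max -mulrA.
  under eq_bigr do rewrite -mulr_sumr.
  by rewrite iterSr -(IH t (markov f)).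
rewrite ltnS => kt; rewrite -(IH _ _ kt).
apply: eq_bigr => om _.
under eq_bigr do rewrite prod_snoc state_snoc // mulrAC mulrC.
by rewrite -mulr_suml -{2}[_ * f _]mul1r -(expect_cst e q 1); congr (_ * _); apply: eq_bigr => c _; rewrite mulr1.
Qed.

Lemma state_mono v t (om : {ffun 'I_t -> config T}) j k : (j <= k)%N ->
  state P v om j \subset state P v om k.
Proof.
move=> jk; rewrite -(subnKC jk); elim: (k - j)%N => [|n IH]; first by rewrite addn0.
rewrite addnS /=; case: insubP => [i _ _|_] //.
by apply: fintype.subset_trans IH _; exact: step_sub.
Qed.

Lemma iter_markov_compl k I :
  iter k markov (fun J => (J != [set: T]%SET)%:R) I =
  1 - iter k markov (fun J => (J == [set: T]%SET)%:R) I.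
Proof.
transitivity (iter k markov (fun J => 1 + -1 * (J == [set: T]%SET)%:R) I); last first.
  by rewrite iter_markovDl iter_markovZ mulN1r.
elim: k I => [|k IH] I /=; first by case: eqP; rewrite /= ?mulr1 ?mulr0 ?subrr ?addr0.
by apply: eq_expect => c; exact: IH.
Qed.

Lemma Pr_rounds_le1 t (E : pred {ffun 'I_t -> config T}) : Pr_rounds e q E <= 1.
Proof.
have one : \sum_(om : {ffun 'I_t -> config T}) \prod_(i < t) config_w e q (om i) = 1.
  have -> : \sum_(om : {ffun 'I_t -> config T}) \prod_(i < t) config_w e q (om i) =
      \prod_(i < t) \sum_c config_w e q c.
    by rewrite bigA_distr_bigA.
  rewrite big1 // => _ _; rewrite -(expect_cst e q 1).
  by apply: eq_bigr => c _; rewrite mulr1.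
rewrite -one [leRHS](bigID E) /= lerDl; apply: sumr_ge0 => om _.
by apply: prodr_ge0 => i _; exact: config_w_ge0.
Qed.

(** If all vertices are informed after [truncn b] rounds but not after [truncn a], then the
    completion time is at least [truncn a] + 1, which exceeds a, also for negative a. *)
Lemma Prob_T_between_ge v (a b : R) : 0 <= b ->
  (Num.truncn a <= Num.truncn b)%N -> [set v]%SET != [set: T]%SET ->
  1 - iter (Num.truncn b) markov (fun J => (J != [set: T]%SET)%:R) [set v]%SET
    - iter (Num.truncn a) markov (fun J => (J == [set: T]%SET)%:R) [set v]%SET
  <= Prob_T_between e P q v a b.
Proof.
move=> b0 ab v1; rewrite /Prob_T_between /Pr_rounds; set t := Num.truncn b.
rewrite iter_markov_compl subKr.
rewrite -!(sum_state v (t := t)) // -sumrB [leRHS]big_mkcond; apply: ler_sum => om _.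
set w := \prod_(i < t) _.
have w0 : 0 <= w by apply: prodr_ge0 => i _; exact: config_w_ge0.
rewrite -mulrBr; case: eqP => [st|_]; last first.
  apply: le_trans (_ : 0 <= _); last by case: ifP.
  by rewrite mulr_ge0_le0 // sub0r oppr_le0 ler0n.
case: eqP => [_|sa]; first by rewrite subrr mulr0; case: ifP.
rewrite subr0 mulr1 ifT //.
have ex : exists k, (state P v om k == [set: T]%SET) by exists t; apply/eqP.
case: (ex_minnP ex) => k /eqP sk kmin; have kt : (k <= t)%N by apply: kmin; apply/eqP.
apply/existsP; exists (Ordinal (kt : (k < t.+1)%N)) => /=.
have kb : k%:R <= b.
  by apply: le_trans (_ : t%:R <= _); rewrite ?ler_nat // /t truncn_le.
have ka : a <= k%:R.
  have : (Num.truncn a < k)%N.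
    rewrite ltnNge; apply/negP => ka; apply: sa; apply/eqP; rewrite -finset.subTset -sk.
    exact: state_mono.
  move=> h; apply: le_trans (_ : (Num.truncn a).+1%:R <= _); last by rewrite ler_nat.
  by rewrite ltW // truncnS_gt.
rewrite ka kb sk eqxx /=; apply/forallP => j; apply/negP => sj.
by have := kmin _ sj; rewrite leqNgt ltn_ord.
Qed.

End Chain.

(** * One-step bounds for reciprocals of set sizes *)

Section Drift.
Variables (R : realType) (T : finType) (e : rel T) (q : R).
Hypothesis q01 : 0 < q <= 1.
Variable (P : protocol).
Local Notation markov := (markov e q P).
Local Notation mean_missed := (mean_missed e q P).

Lemma card_setC_natr (S : {set T}) : #|~: S|%:R = #|T|%:R - #|S|%:R :> R.
Proof. by rewrite -(cardsC S) natrD addrC addKr. Qed.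

Lemma markov_card (I : {set T}) :
  markov (fun J => #|J|%:R) I = #|T|%:R - mean_missed I.
Proof.
rewrite -expect_card_missed /markov -mulN1r -expectZ -(expect_cst e q #|T|%:R) -expectD.
by apply: eq_expect => c; rewrite card_setC_natr; ring.
Qed.

(** [expect_inv_le] with lower bound |I|, since informed vertices stay informed; the variance is at
    most a - |I|, the mean number of newly informed vertices. *)
Lemma markov_inv_card_le (I : {set T}) (a := #|T|%:R - mean_missed I) :
  (0 < #|I|)%N ->
  markov (fun J => (#|J|%:R)^-1) I <= a^-1 + (a - #|I|%:R) / (a ^+ 2 * #|I|%:R).
Proof.
move=> I0; have i0 : 0 < #|I|%:R :> R by rewrite ltr0n.
have h := @expect_inv_le _ _ e q q01 (fun c => #|step P I c|%:R) #|I|%:R i0.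
apply: le_trans (h _) _ => [c|].
  by rewrite ler_nat; apply: subset_leq_card; exact: step_sub.
have -> : expect e q (fun c => #|step P I c|%:R) = a := markov_card I.
have ai2 : 0 <= (a ^+ 2 * #|I|%:R)^-1 by rewrite invr_ge0 mulr_ge0 ?sqr_ge0 // ltW.
rewrite lerD2l ler_wpM2r //.
have [_] := var_card_missed e q01 P I.
rewrite card_setC_natr /a; set x := #|T|%:R; set y := mean_missed I => hV.
apply: le_trans (_ : x - #|I|%:R - y <= _); last by lra.
apply: le_trans hV; rewrite le_eqVlt; apply/orP; left; apply/eqP.
by apply: eq_expect => c; rewrite card_setC_natr -/x; ring.
Qed.

Section Growth.
Variables (I : {set T}) (m : R).
Hypothesis I0 : (0 < #|I|)%N.
Hypothesis m0 : 0 < m.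
Hypothesis grow : mean_missed I <= #|~: I|%:R - m * #|I|%:R.

Let a := #|T|%:R - mean_missed I.
Let i : R := #|I|%:R.
Let i1 : 1 <= i. Proof. by rewrite ler1n. Qed.
Let i0 : 0 < i. Proof. exact: lt_le_trans ltr01 i1. Qed.
Let ai : (1 + m) * i <= a.
Proof. by move: grow; rewrite card_setC_natr /a -/i; lra. Qed.
Let a0 : 0 < a.
Proof. by apply: lt_le_trans ai; rewrite mulr_gt0 // addr_gt0. Qed.
Let ia : i / a <= (1 + m)^-1.
Proof. by rewrite ler_pdivrMr // mulrC ler_pdivlMr ?addr_gt0 // mulrC. Qed.

(** A factor below 1 valid from a single informed vertex on; it serves only to reach a large
    constant size. *)
Lemma markov_inv_card_le_any :
  markov (fun J => (#|J|%:R)^-1) I <= (1 - (m / (1 + m)) ^+ 2) * #|I|%:R^-1.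
Proof.
apply: le_trans (markov_inv_card_le I0) _; rewrite -/a -/i.
have ia1 : m / (1 + m) <= 1 - i / a.
  have -> : m / (1 + m) = 1 - (1 + m)^-1 by field; rewrite gt_eqF // addr_gt0.
  by rewrite lerD2l lerN2.
have mm0 : 0 <= m / (1 + m) by rewrite divr_ge0 ?addr_ge0 ?(ltW m0).
apply: le_trans (_ : (1 - (1 - i / a) ^+ 2) * i^-1 <= _); last first.
  rewrite ler_wpM2r ?invr_ge0 ?(ltW i0) // lerD2l lerN2.
  by rewrite lerXn2r ?nnegrE // (le_trans mm0).
(* Multiplying the variance term by i >= 1 completes the square. *)
have -> : (1 - (1 - i / a) ^+ 2) * i^-1 = a^-1 + (a - i) * i / (a ^+ 2 * i).
  by field; rewrite !gt_eqF.
have ai2 : 0 <= (a ^+ 2 * i)^-1 by rewrite invr_ge0 mulr_ge0 ?sqr_ge0 // ltW.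
rewrite lerD2l ler_wpM2r //.
rewrite ler_peMr // subr_ge0; apply: le_trans ai.
by rewrite ler_peMl ?(ltW i0) // lerDl ltW.
Qed.

(** The sharp factor 1 / (1 + m), with an error that is negligible once I is large. *)
Lemma markov_inv_card_le_large :
  markov (fun J => (#|J|%:R)^-1) I <= ((1 + m)^-1 + #|I|%:R^-1) * #|I|%:R^-1.
Proof.
apply: le_trans (markov_inv_card_le I0) _; rewrite -/a -/i.
have -> : a^-1 + (a - i) / (a ^+ 2 * i) = (i / a + (a - i) / a ^+ 2) * i^-1.
  by field; rewrite !gt_eqF.
rewrite ler_wpM2r ?invr_ge0 ?(ltW i0) // lerD //.
apply: le_trans (_ : a / a ^+ 2 <= _).
  by rewrite ler_wpM2r ?invr_ge0 ?sqr_ge0 // gerBl ltW.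
have -> : a / a ^+ 2 = a^-1 by field; rewrite gt_eqF.
rewrite lef_pV2 ?posrE //; apply: le_trans ai.
by rewrite ler_peMl ?(ltW i0) // lerDl ltW.
Qed.

End Growth.

(** The shift K bounds the reciprocal when no vertex is left, and reduces the variance term to a
    fraction 1 / (r K) of the main one. *)
Lemma markov_inv_shift_le (I : {set T}) (K r : R) : 0 < K -> 0 < r <= 1 ->
  #|~: I|%:R * r <= mean_missed I ->
  markov (fun J => (K + #|~: J|%:R)^-1) I <=
  (r^-1 * (1 + (r * K)^-1)) * (K + #|~: I|%:R)^-1.
Proof.
move=> K0 /andP[r0 r1] hr; set u : R := #|~: I|%:R.
have u0 : 0 <= u by rewrite ler0n.
pose a := K + mean_missed I.
have aE : expect e q (fun c => K + #|~: step P I c|%:R) = a.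
  by rewrite expectD expect_cst expect_card_missed.
have ar : r * (K + u) <= a.
  rewrite mulrDr /a; apply: lerD; last by rewrite mulrC.
  by rewrite ler_piMl // ltW.
have Ku : 0 < K + u by rewrite ltr_wpDr.
have a0 : 0 < a by apply: lt_le_trans ar; rewrite mulr_gt0.
have h := @expect_inv_le _ _ e q q01 (fun c => K + #|~: step P I c|%:R) K K0.
apply: le_trans (h _) _ => [c|]; first by rewrite lerDl ler0n.
rewrite aE.
have hV : expect e q (fun c => (K + #|~: step P I c|%:R - a) ^+ 2) <= K + u.
  have [_ hV] := var_card_missed e q01 P I.
  apply: le_trans (_ : u - mean_missed I <= _); last first.
    have : 0 <= mean_missed I by apply: le_trans hr; rewrite mulr_ge0 // ltW.
    by move=> mm; rewrite lerBlDr; lra.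
  apply: le_trans hV; rewrite le_eqVlt; apply/orP; left; apply/eqP.
  by apply: eq_expect => c; rewrite /a; ring.
apply: le_trans (_ : a^-1 + (K + u) / (a ^+ 2 * K) <= _).
  by rewrite lerD2l ler_wpM2r // invr_ge0 mulr_ge0 ?sqr_ge0 // ltW.
have -> : a^-1 + (K + u) / (a ^+ 2 * K) = a^-1 * (1 + (K + u) / a / K).
  by field; rewrite !gt_eqF.
have inva : a^-1 <= r^-1 * (K + u)^-1.
  by rewrite -invfM lef_pV2 ?posrE // mulr_gt0.
rewrite [leRHS]mulrAC; apply: ler_pM => //.
- by rewrite invr_ge0 ltW.
- by rewrite addr_ge0 // !mulr_ge0 ?invr_ge0 // ltW.
rewrite lerD2l [X in _ <= X]invfM ler_wpM2r ?invr_ge0 ?(ltW K0) //.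
by rewrite ler_pdivrMr // mulrC ler_pdivlMr // mulrC.
Qed.

End Drift.
(** * Phases on expander sequences *)

(** All that the phases use of an expander, with a single tolerance eta for the degree ratio, the
    size of the degrees and the overlaps. *)
Definition near_regular (R : realType) (N : nat) (e : rel 'I_N) (eta : R)
    (d := (mindeg e)%:R : R) (D := (maxdeg e)%:R : R) : Prop :=
  [/\ symmetric e, 0 < d /\ eta^-1 <= d, D / d <= 1 + eta, 1 - eta <= d / D &
    forall S : {set 'I_N}, \sum_w nbrs R e S w ^+ 2 <=
      D ^+ 2 * (#|S|%:R * ((1 + eta) * (#|S|%:R / N%:R) + eta))].

Lemma degree_bounds (R : realType) (N : nat) (e : rel 'I_N) (u : 'I_N) :
  (mindeg e)%:R <= ((deg e u)%:R : R) <= (maxdeg e)%:R.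
Proof. by rewrite !ler_nat mindeg_le maxdeg_ge. Qed.

Lemma maxdeg_gt0 (R : realType) (N : nat) (e : rel 'I_N) :
  (0 < N)%N -> 0 < (mindeg e)%:R :> R -> 0 < (maxdeg e)%:R :> R.
Proof.
move=> N0 d0; have /andP[h1 h2] := degree_bounds R e (Ordinal N0).
exact: lt_le_trans d0 (le_trans h1 h2).
Qed.

Lemma near_regular_of_spectrum (R : realType) (N : nat) (e : rel 'I_N) (sp : seq R)
    (eta0 eps eta : R) (d := (mindeg e)%:R : R) (D := (maxdeg e)%:R : R) :
  (1 < N)%N -> symmetric e -> adj_spectrum e sp ->
  0 < eta0 <= 1 -> eta0 <= eta / 8 -> 0 < eps <= 1 / 2 -> eps <= eta ->
  eps * (4 + 3 * eta0^-1) <= eta0 -> 16 / eta <= N%:R ->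
  `|1 - D / d| < eps -> `|0 - spec_lambda N sp / D| < eps ->
  near_regular e eta.
Proof.
move=> N1 symE spE /andP[eta00 eta01] eta0e /andP[eps0 eps2] epse epsb Nb hD hl.
have N0 : 0 < N%:R :> R by rewrite ltr0n ltnW.
have eta_gt0 : 0 < eta by lra.
have d0 : 0 < d.
  rewrite lt_def ler0n andbT; apply/eqP => dz.
  by move: hD; rewrite dz invr0 mulr0 subr0 normr1; lra.
have D0 : 0 < D by apply: maxdeg_gt0 => //; rewrite ltnW.
have dD : d <= D.
  by have /andP[h1 h2] := degree_bounds R e (Ordinal (ltnW N1)); apply: le_trans h1 h2.
have Dd : D / d <= 1 + eps by move: hD; rewrite ltr_norml => /andP[h1 h2]; lra.
have dDe : 1 - eps <= d / D.
  rewrite ler_pdivlMr //; move: Dd; rewrite ler_pdivrMr // => Dd.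
  have : (1 - eps) * D <= (1 - eps) * ((1 + eps) * d) by rewrite ler_wpM2l //; lra.
  have : 0 <= eps ^+ 2 * d by rewrite mulr_ge0 ?sqr_ge0 // ltW.
  by lra.
have dD1 : d / D <= 1 by rewrite ler_pdivrMr // mul1r.
have lD : (spec_lambda N sp / D) ^+ 2 <= eps.
  move: hl; rewrite sub0r normrN => hl.
  rewrite -[leLHS]real_normK ?num_real //.
  have : `|spec_lambda N sp / D| ^+ 2 <= eps ^+ 2 by rewrite lerXn2r ?nnegrE ?normr_ge0 ?(ltW eps0) ?(ltW hl).
  have e2 : eps ^+ 2 <= eps by rewrite expr2 ler_piMl ?(ltW eps0) //; lra.
  by lra.
have dD2 : 1 - 2 * eps <= (d / D) ^+ 2.
  have : (1 - eps) ^+ 2 <= (d / D) ^+ 2.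
    by rewrite lerXn2r ?nnegrE ?divr_ge0 ?(ltW d0) ?(ltW D0) //; lra.
  by have : 0 <= eps ^+ 2 := sqr_ge0 _; lra.
have cond : (spec_lambda N sp / D) ^+ 2 + (1 + eta0^-1) *
    (1 - (d / D) ^+ 2 + (spec_lambda N sp / D) ^+ 2) <= eta0.
  apply: le_trans epsb.
  (* Origin of the factor 4 + 3 / eta0: (lam / D)^2 <= eps, and 1 - (d / D)^2 adds at most 2 eps to
     it in the second term. *)
  apply: le_trans (_ : eps + (1 + eta0^-1) * (3 * eps) <= _); last by lra.
  apply: lerD => //; rewrite ler_wpM2l //; last by lra.
  by rewrite addr_ge0 // invr_ge0 ltW.
have spr := fun S => @nbrs_sqr_le R N e sp d D (spec_lambda N sp) symE N1 spE erefl
  (degree_bounds R e) d0 eta0 S eta00 cond.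
have mono S : (#|S|%:R : R) * ((1 + eta0) * (#|S|%:R / N%:R) + eta0) <=
    #|S|%:R * ((1 + eta) * (#|S|%:R / N%:R) + eta).
  rewrite ler_wpM2l ?ler0n // lerD //; last by lra.
  by rewrite ler_wpM2r ?divr_ge0 ?ler0n //; lra.
split => //; last first.
- by move=> S; apply: le_trans (spr S) _; rewrite ler_wpM2l ?sqr_ge0.
- by lra.
- by lra.
split => //.
(* For a single vertex the sum of squares is its degree, so d <= D^2 eta / 4; with D <= 2 d this
   forces d >= 1 / eta. *)
have := spr [set Ordinal (ltnW N1)]%SET; rewrite cards1 mul1r -/D.
have -> : \sum_w nbrs R e [set Ordinal (ltnW N1)]%SET w ^+ 2 = (deg e (Ordinal (ltnW N1)))%:R.
  rewrite degE; apply: eq_bigr => w _; rewrite /nbrs big_set1.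
  by case: (e _ w); rewrite ?expr1n ?expr0n.
have /andP[h1 _] := degree_bounds R e (Ordinal (ltnW N1)).
move=> h2; have {h1 h2} h : d <= D ^+ 2 * ((1 + eta0) * (1 / N%:R) + eta0) := le_trans h1 h2.
have NI : 1 / N%:R <= eta / 16.
  rewrite ler_pdivrMr // -ler_pdivrMl ?divr_gt0 // mulr1.
  by rewrite invf_div.
have h3 : (1 + eta0) * (1 / N%:R) + eta0 <= eta / 4.
  have : (1 + eta0) * (1 / N%:R) <= 2 * (eta / 16).
    by rewrite ler_pM // ?addr_ge0 ?divr_ge0 ?(ltW eta00) ?(ltW N0) //; lra.
  by lra.
have D2 : D <= 2 * d by move: Dd; rewrite ler_pdivrMr // => Dd; nra.
have D4 : D ^+ 2 <= 4 * d ^+ 2.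
  have : D ^+ 2 <= (2 * d) ^+ 2 by rewrite lerXn2r ?nnegrE ?mulr_ge0 ?(ltW D0) ?(ltW d0).
  by lra.
have : d <= (4 * d ^+ 2) * (eta / 4).
  apply: le_trans h _; apply: ler_pM => //; first exact: sqr_ge0.
  by rewrite addr_ge0 ?mulr_ge0 ?addr_ge0 ?divr_ge0 ?(ltW eta00) ?(ltW N0).
have -> : (4 * d ^+ 2) * (eta / 4) = d * (d * eta) by field.
rewrite -[leLHS]mulr1 ler_pM2l // => hh.
by rewrite -div1r ler_pdivrMr.
Qed.

Lemma expander_near_regular (R : realType) (G : forall n : nat, rel 'I_n.+1) (eta : R) :
  expander_sequence R G -> 0 < eta ->
  (\forall n \near \oo, near_regular (G n) eta)%classic.
Proof.
move=> [simp [ratio [spec [specE lam0]]]] eta_gt0.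
pose eta0 := Num.min 1 (eta / 8).
have eta00 : 0 < eta0 by rewrite lt_min ltr01 divr_gt0.
have b0 : 0 < 4 + 3 * eta0^-1 by rewrite addr_gt0 // mulr_gt0 // invr_gt0.
pose eps := Num.min (1 / 2) (Num.min eta (eta0 / (4 + 3 * eta0^-1))).
have eps0 : 0 < eps by rewrite !lt_min eta_gt0 !divr_gt0.
have /cvgrPdist_lt/(_ eps eps0) hr := ratio.
have /cvgrPdist_lt/(_ eps eps0) hl := lam0.
near=> n.
apply: (@near_regular_of_spectrum _ _ _ (spec n) eta0 eps) => //.
- by rewrite ltnS; near: n; exact: nbhs_infty_gt.
- by case: (simp n) => -[].
- by rewrite eta00 ge_min lexx.
- by rewrite ge_min lexx orbT.
- by rewrite eps0 ge_min lexx.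
- by rewrite !ge_min lexx orbT.
- by rewrite -ler_pdivlMr // !ge_min lexx !orbT.
- apply: le_trans (_ : n%:R <= _); last by rewrite ler_nat.
  by near: n; exact: nbhs_infty_ger.
- by near: n.
- by near: n.
Unshelve. all: by end_near. Qed.

Section PhaseDrift.
Variables (R : realType) (q : R) (P : protocol).
Hypothesis q01 : 0 < q <= 1.
Local Notation gamma := (growth_rate q P).
Local Notation rho := (decay_rate q P).

Let q0 : 0 < q. Proof. by case/andP: q01. Qed.
Let q1 : q <= 1. Proof. by case/andP: q01. Qed.

Lemma near_regular_spread N (e : rel 'I_N) (eta th : R) (S : {set 'I_N}) :
  near_regular e eta -> (1 + eta) * (#|S|%:R / N%:R) + eta <= th ^+ 2 ->
  spread e (maxdeg e)%:R S th.
Proof.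
move=> [_ _ _ _ spr] hth; apply: le_trans (spr S) _.
by rewrite ler_wpM2l ?sqr_ge0 // ler_wpM2l ?ler0n.
Qed.

(* The choice th <= (gamma - m)/(2 gamma + 2) gives gamma (1 - 2 th) - 2 th^2 >= m. *)
Lemma growth_drift (m : R) : 0 < m < gamma ->
  exists eps eta : R, [/\ 0 < eps <= 1, 0 < eta & forall N (e : rel 'I_N) (I : {set 'I_N}),
    (0 < N)%N -> near_regular e eta -> #|I|%:R <= eps * N%:R ->
    mean_missed e q P I <= #|~: I|%:R - m * #|I|%:R].
Proof.
case/andP=> m0 mg; have g0 : 0 < gamma := lt_trans m0 mg.
pose th := Num.min 1 ((gamma - m) / (2 * gamma + 2)).
have gp : 0 < 2 * gamma + 2 by rewrite addr_gt0 // mulr_gt0.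
have th0 : 0 < th by rewrite lt_min ltr01 divr_gt0 // subr_gt0.
have th1 : th <= 1 by rewrite ge_min lexx.
have thg : th * (2 * gamma + 2) <= gamma - m.
  by rewrite -ler_pdivlMr // ge_min lexx orbT.
have th2 : th ^+ 2 <= th by rewrite expr2 ler_piMl // ltW.
have th20 : 0 < th ^+ 2 by rewrite exprn_gt0.
(* Chosen so that (1 + eta) eps + eta <= th^2, the condition of [near_regular_spread]. *)
exists (th ^+ 2 / 4), (th ^+ 2 / 2); split; [by lra|by lra|].
move=> N e I N0 nr hI; have N0R : 0 < N%:R :> R by rewrite ltr0n.
have [symE [d0 _] _ dD _] := nr.
have D0 := maxdeg_gt0 N0 d0.
have spI : spread e (maxdeg e)%:R I th.
  apply: near_regular_spread nr _.
  have IN : #|I|%:R / N%:R <= th ^+ 2 / 4 by rewrite ler_pdivrMr.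
  have IN0 : 0 <= #|I|%:R / N%:R :> R by rewrite divr_ge0 ?ler0n.
  have : (1 + th ^+ 2 / 2) * (#|I|%:R / N%:R) <= 2 * (th ^+ 2 / 4) by rewrite ler_pM //; lra.
  by lra.
apply: le_trans (mean_missed_le_growth q01 symE d0 D0 (degree_bounds R e) P th0 spI) _.
rewrite lerD2l lerN2 mulrC ler_wpM2l ?ler0n //.
set x := (mindeg e)%:R / _ in dD *.
have : gamma * (1 - th - th) <= gamma * (x - th) by rewrite ler_wpM2l ?(ltW g0) //; lra.
by lra.
Qed.

Lemma decay_drift (kappa : R) : rho < kappa ->
  exists eps eta : R, [/\ 0 < eps < 1, 0 < eta & forall N (e : rel 'I_N) (I : {set 'I_N}),
    (0 < N)%N -> near_regular e eta -> #|~: I|%:R <= eps * N%:R ->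
    mean_missed e q P I <= kappa * #|~: I|%:R].
Proof.
(* The excess over rho in [mean_missed_le_decay] is 2 (1 - d / D) + 2 th <= th^2 + 2 th <= 3 th. *)
move=> rk; pose th := Num.min 1 ((kappa - rho) / 4).
have th0 : 0 < th by rewrite lt_min ltr01 divr_gt0 // subr_gt0.
have th1 : th <= 1 by rewrite ge_min lexx.
have thk : th <= (kappa - rho) / 4 by rewrite ge_min lexx orbT.
have th2 : th ^+ 2 <= th by rewrite expr2 ler_piMl // ltW.
have th20 : 0 < th ^+ 2 by rewrite exprn_gt0.
exists (th ^+ 2 / 4), (th ^+ 2 / 2); split; [by lra|by lra|].
move=> N e I N0 nr hI; have N0R : 0 < N%:R :> R by rewrite ltr0n.
have [symE [d0 _] _ dD _] := nr.
have D0 := maxdeg_gt0 N0 d0.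
have spU : spread e (maxdeg e)%:R (~: I) th.
  apply: near_regular_spread nr _.
  have IN : #|~: I|%:R / N%:R <= th ^+ 2 / 4 by rewrite ler_pdivrMr.
  have IN0 : 0 <= #|~: I|%:R / N%:R :> R by rewrite divr_ge0 ?ler0n.
  have : (1 + th ^+ 2 / 2) * (#|~: I|%:R / N%:R) <= 2 * (th ^+ 2 / 4) by rewrite ler_pM //; lra.
  by lra.
apply: le_trans (mean_missed_le_decay q01 symE d0 D0 (degree_bounds R e) P th0 spU) _.
by rewrite mulrC ler_wpM2r ?ler0n //; lra.
Qed.

Lemma contract_drift (eps : R) : 0 < eps <= 1 ->
  exists kappa eta : R, [/\ 0 <= kappa < 1, 0 < eta & forall N (e : rel 'I_N) (I : {set 'I_N}),
    (0 < N)%N -> near_regular e eta -> #|~: I|%:R <= (1 - eps) * N%:R ->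
    mean_missed e q P I <= kappa * #|~: I|%:R].
Proof.
case/andP=> e0 e1; have qe0 : 0 < q * eps by rewrite mulr_gt0.
have qe1 : q * eps <= 1 by rewrite mulr_ile1 // ltW.
(* With th = 1 - eps / 4 one has (1 + eps / 8)(1 - eps) + eps / 8 <= th^2 and d / D - th >= eps /
   8. *)
exists (1 - q / 2 * (eps / 8)), (eps / 8); split; [by lra|by lra|].
move=> N e I N0 nr hI; have N0R : 0 < N%:R :> R by rewrite ltr0n.
have [symE [d0 _] _ dD _] := nr.
have D0 := maxdeg_gt0 N0 d0.
have th0 : 0 < 1 - eps / 4 by lra.
have spU : spread e (maxdeg e)%:R (~: I) (1 - eps / 4).
  apply: near_regular_spread nr _.
  have IN : #|~: I|%:R / N%:R <= 1 - eps by rewrite ler_pdivrMr.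
  have IN0 : 0 <= #|~: I|%:R / N%:R :> R by rewrite divr_ge0 ?ler0n.
  have : (1 + eps / 8) * (#|~: I|%:R / N%:R) <= (1 + eps / 8) * (1 - eps) by rewrite ler_wpM2l //; lra.
  have : 0 <= eps ^+ 2 := sqr_ge0 _.
  by lra.
apply: le_trans (mean_missed_le_contract q01 symE d0 D0 (degree_bounds R e) P th0 spU) _.
rewrite mulrC ler_wpM2r ?ler0n // lerD2l lerN2 ler_wpM2l ?divr_ge0 ?(ltW q0) //.
by set x := (mindeg e)%:R / _ in dD *; lra.
Qed.

Lemma growth_upper (kappa : R) : 1 + gamma < kappa ->
  exists eta : R, 0 < eta /\ forall N (e : rel 'I_N) (I : {set 'I_N}),
    (0 < N)%N -> near_regular e eta ->
    markov e q P (fun J => #|J|%:R) I <= kappa * #|I|%:R.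
Proof.
move=> gk; have g0 : 0 <= gamma := growth_rate_ge0 q01 P.
exists ((kappa - 1 - gamma) / (1 + gamma)).
have gp : 0 < 1 + gamma by lra.
split; first by rewrite divr_gt0 //; lra.
move=> N e I N0 nr.
have [symE [d0 _] Dd _ _] := nr.
have D0 := maxdeg_gt0 N0 d0.
rewrite markov_card lerBlDr.
have := mean_missed_ge_growth q01 symE d0 (degree_bounds R e) P I.
rewrite (card_setC_natr R).
set x := (maxdeg e)%:R / _ in Dd *; set i := #|I|%:R; set M := mean_missed _ _ _ _ => h.
have i0 : 0 <= i by rewrite ler0n.
have : gamma * x * i <= (kappa - 1) * i.
  rewrite ler_wpM2r //; apply: le_trans (_ : gamma * (1 + (kappa - 1 - gamma) / (1 + gamma)) <= _).
    by rewrite ler_wpM2l.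
  have -> : gamma * (1 + (kappa - 1 - gamma) / (1 + gamma)) = gamma * kappa / (1 + gamma).
    by field; rewrite gt_eqF.
  by rewrite ler_pdivrMr //; lra.
by lra.
Qed.

Lemma decay_lower (r : R) : 0 < r < rho ->
  exists eta : R, 0 < eta /\ forall N (e : rel 'I_N) (I : {set 'I_N}),
    (0 < N)%N -> near_regular e eta -> #|~: I|%:R * r <= mean_missed e q P I.
Proof.
case/andP=> r0 rr; have rho0 : 0 < rho := lt_trans r0 rr.
pose tau := ln (rho / r).
have tau0 : 0 < tau by rewrite ln_gt0 // ltr_pdivlMr // mul1r.
(* From D <= (1 + eta) d and q <= eta d, the wanted q D / (d - q) <= q + tau reduces to eta (2 q +
   tau) <= tau, and q <= 1. *)
pose eta := tau / (2 + tau).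
have tp : 0 < 2 + tau by rewrite addr_gt0.
have eta0 : 0 < eta by rewrite divr_gt0.
have eta1 : eta < 1 by rewrite ltr_pdivrMr // mul1r ltrDr.
exists eta; split => // N e I N0 nr.
have [symE [d0 dbig] Dd _ _] := nr.
have D0 := maxdeg_gt0 N0 d0.
set d := (mindeg e)%:R in d0 dbig Dd *; set D := (maxdeg e)%:R in Dd D0 *.
have etad : 1 <= eta * d by rewrite -ler_pdivrMl // mulr1.
have qd : q < d.
  apply: le_lt_trans q1 _; apply: le_lt_trans etad _.
  by rewrite gtr_pMl.
apply: le_trans (mean_missed_ge_decay q01 symE d0 (degree_bounds R e) P I qd).
rewrite ler_wpM2l ?ler0n //.
have -> : r = expR (- tau) * rho.
  rewrite expRN lnK ?posrE ?divr_gt0 // invf_div divfK // gt_eqF //.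
rewrite /decay_rate mulrA -expRD ler_wpM2r //.
  by rewrite subr_ge0 mulr_ile1 ?ler0n ?(ltW q0) //; case: (pulls P).
rewrite ler_expR -opprD lerN2.
have dq : 0 < d - q by rewrite subr_gt0.
have frac : q * D / (d - q) <= q + tau.
  rewrite ler_pdivrMr //.
  have Dd' : D <= (1 + eta) * d by rewrite -ler_pdivrMr.
  have etat : eta * (2 + tau) = tau by rewrite /eta divfK // gt_eqF.
  have h1 : q * D <= q * ((1 + eta) * d) by rewrite ler_wpM2l // ltW.
  apply: (le_trans h1).
  have qe : q <= eta * d by apply: le_trans q1 etad.
  have h2 : (q + tau) * (d - eta * d) <= (q + tau) * (d - q).
    by rewrite ler_wpM2l ?lerD2l ?lerN2 // addr_ge0 // ltW.
  apply: le_trans h2.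
  have -> : (q + tau) * (d - eta * d) = (q * (1 - eta) + tau * (1 - eta)) * d by ring.
  rewrite mulrA ler_wpM2r ?(ltW d0) //.
  have : 2 * eta * q <= 2 * eta * 1 by rewrite ler_wpM2l // mulr_ge0 // ltW.
  by lra.
case: (pushes P) => /=; last by rewrite !mul0r mulr0 addr0 ltW.
by rewrite mul1r mulr1 [tau + q]addrC.
Qed.

End PhaseDrift.

(** * Durations of the phases along the sequence *)

Section Asymptotics.
Variable R : realType.

Lemma ln_nat_large (M : R) : \forall n \near eventually, M <= ln (n.+1%:R : R).
Proof.
near=> n; rewrite -(expRK M) ler_ln ?posrE ?expR_gt0 ?ltr0n //.
apply: le_trans (_ : n%:R <= _); last by rewrite ler_nat.
by near: n; exact: nbhs_infty_ger.
Unshelve. all: by end_near. Qed.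

Lemma expR_ln_nat_small (b eps : R) : 0 < b -> 0 < eps ->
  \forall n \near eventually, expR (- (b * ln (n.+1%:R : R))) <= eps.
Proof.
move=> b0 eps0; apply: filterS (ln_nat_large (- ln eps / b)) => n h.
rewrite -(lnK (x := eps)) ?posrE // ler_expR lerNl.
by rewrite mulrC -ler_pdivrMr.
Qed.

Lemma pow_ln_small (a kappa eps : R) : 0 < a -> 0 <= kappa < expR (- a^-1) -> 0 < eps ->
  \forall n \near eventually, forall k : nat, a * ln (n.+1%:R : R) <= k%:R ->
    kappa ^+ k * n.+1%:R <= eps.
Proof.
move=> a0 /andP[k0 ka] eps0.
(* [kappa] may be 0; the larger base [kap] is positive, so its logarithm is meaningful. *)
pose kap := (kappa + expR (- a^-1)) / 2.
have e0 := expR_gt0 (- a^-1).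
have kap0 : 0 < kap by rewrite divr_gt0 // ltr_wpDl.
have kkap : kappa <= kap by rewrite /kap; lra.
have kapa : kap < expR (- a^-1) by rewrite /kap; lra.
pose b := - ln kap.
have ba : 1 < a * b.
  rewrite mulrC -ltr_pdivrMr // div1r /b ltrNr -(expRK (- a^-1)) ltr_ln ?posrE //.
have b0 : 0 < b by rewrite -(pmulr_rgt0 _ a0); apply: lt_trans ba.
apply: filterS (expR_ln_nat_small (b := a * b - 1) _ eps0); last by rewrite subr_gt0.
move=> n h k ak.
apply: le_trans h; apply: le_trans (_ : kap ^+ k * n.+1%:R <= _).
  by rewrite ler_wpM2r ?ler0n // lerXn2r // nnegrE ltW.
have -> : kap = expR (- b) by rewrite opprK lnK.
rewrite -expRM_natl -{1}(lnK (x := n.+1%:R)) ?posrE ?ltr0n // -expRD ler_expR.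
have := ler_wpM2r (ltW b0) ak; lra.
Qed.

Lemma pow_ln_small_growth (a kappa eps : R) : 0 < a -> 1 <= kappa < expR (a^-1) -> 0 < eps ->
  \forall n \near eventually, forall k : nat, k%:R <= a * ln (n.+1%:R : R) ->
    kappa ^+ k / n.+1%:R <= eps.
Proof.
move=> a0 /andP[k1 ka] eps0; pose b := ln kappa.
have kap0 : 0 < kappa by apply: lt_le_trans k1.
have b0 : 0 <= b by rewrite ln_ge0.
have ba : a * b < 1.
  by rewrite mulrC -ltr_pdivlMr // div1r -(expRK a^-1) ltr_ln ?posrE ?expR_gt0.
apply: filterS (expR_ln_nat_small (b := 1 - a * b) _ eps0); last by rewrite subr_gt0.
move=> n h k ak; apply: le_trans h.
rewrite -{1}(lnK (x := kappa)) ?posrE // -/b -expRM_natl.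
rewrite -{1}(lnK (x := n.+1%:R)) ?posrE ?ltr0n // -expRN -expRD ler_expR.
have := ler_wpM2r b0 ak; lra.
Qed.

Lemma pow_small (kappa eps : R) : 0 <= kappa < 1 -> 0 < eps -> exists t, kappa ^+ t <= eps.
Proof.
move=> /andP[k0 k1] eps0.
have : (@GRing.exp R kappa @ eventually --> (0 : R))%classic by apply: cvg_expr; rewrite ger0_norm.
move/cvgrPdist_le => /(_ eps eps0)[t _ /(_ t (leqnn t))] /=.
by rewrite sub0r normrN ger0_norm ?exprn_ge0 // => h; exists t.
Qed.

Unset Implicit Arguments.
Variables (G : forall n : nat, rel 'I_n.+1) (q : R) (P : protocol).
Hypothesis expG : expander_sequence R G.
Hypothesis q01 : 0 < q <= 1.
Variable v : forall n : nat, 'I_n.+1.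
Set Implicit Arguments.
Local Notation gamma := (growth_rate q P).
Local Notation rho := (decay_rate q P).
Local Notation L n := (ln (n.+1%:R : R)).
Local Notation mk n := (markov (G n) q P).

Let nat_large (x : R) : \forall n \near eventually, x <= n.+1%:R.
Proof.
near=> n; apply: le_trans (_ : n%:R <= _); last by rewrite ler_nat.
by near: n; exact: nbhs_infty_ger.
Unshelve. all: by end_near. Qed.

(** The constant c0 pays for the warm-up from one vertex to M vertices, whose length depends on err,
    while eps does not. *)
Lemma phase_growth (a : R) : 0 < a -> expR a^-1 < 1 + gamma ->
  exists eps : R, 0 < eps <= 1 /\ forall err : R, 0 < err -> exists c0 : nat,
    \forall n \near eventually, forall k : nat, a * L n + c0%:R <= k%:R ->
      iter k (mk n) (fun J => (~~ (eps * n.+1%:R <= #|J|%:R))%:R) [set v n]%SET <= err.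
Proof.
move=> a0 ag; have e1 : 1 < expR a^-1 by rewrite -expR0 ltr_expR invr_gt0.
pose E := expR a^-1.
have E0 : 0 < E := expR_gt0 _.
(* 1 + m is the midpoint of e^(1/a) and 1 + gamma; kap that of (1+m)^-1 and e^(-1/a) *)
pose m := (E + (1 + gamma)) / 2 - 1.
have m0 : 0 < m by rewrite /m /E; lra.
have mg : m < gamma by rewrite /m /E; lra.
have Em : E < 1 + m by rewrite /m /E; lra.
have mE : (1 + m)^-1 < E^-1 by rewrite ltf_pV2 ?posrE //; lra.
pose kap := ((1 + m)^-1 + E^-1) / 2.
have kapE : kap < expR (- a^-1) by rewrite expRN -/E /kap; lra.
have m1 : 0 < (1 + m)^-1 by rewrite invr_gt0; lra.
have Ei : 0 < E^-1 by rewrite invr_gt0.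
have kap0 : 0 <= kap by rewrite /kap; lra.
(* M is so large that the error 1 / |I| of [markov_inv_card_le_large] fits between 1 / (1 + m) and
   [kap]. *)
pose M := (Num.truncn (kap - (1 + m)^-1)^-1).+1.
have dk0 : 0 < kap - (1 + m)^-1 by rewrite /kap; lra.
have M0 : 0 < M%:R :> R by rewrite ltr0n.
have MV : (M%:R)^-1 <= kap - (1 + m)^-1.
  rewrite -[leRHS]invrK lef_pV2 ?posrE ?invr_gt0 //.
  by rewrite ltW // truncnS_gt.
have [|eps [eta [/andP[eps0 eps1] eta0 drift]]] := @growth_drift R q P q01 m; first by rewrite m0.
exists eps; split; first by rewrite eps0.
move=> err err0; pose kapa := 1 - (m / (1 + m)) ^+ 2.
have kapa01 : 0 <= kapa < 1.
  have h0 : 0 < m / (1 + m) by rewrite divr_gt0 // addr_gt0.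
  have h1 : m / (1 + m) <= 1 by rewrite ler_pdivrMr; lra.
  have : 0 < (m / (1 + m)) ^+ 2 <= 1 by rewrite exprn_gt0 // exprn_ile1 // ltW.
  by rewrite /kapa; lra.
(* The warm-up starts with 1 / |I| = 1 and fails only if 1 / |I| is still at least 1 / M, hence with
   probability at most M times the t-th power of [kapa]. *)
have [|t ht] := pow_small (eps := err / 2 / M%:R) kapa01; first by rewrite !divr_gt0.
exists t.
have err20 : 0 < err / 2 by rewrite divr_gt0.
have kapP : 0 <= kap < expR (- a^-1) by rewrite kap0.
apply: filterS3 (expander_near_regular expG eta0) (pow_ln_small a0 kapP err20) (nat_large (M%:R / eps)) => n nr hk hM k hak.
have tk : (t <= k)%N.
  by rewrite -(ler_nat R); apply: le_trans hak; rewrite lerDr mulr_ge0 ?(ltW a0) // ln_ge0 // ler1n.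
have hM' : M%:R <= eps * n.+1%:R by rewrite mulrC -ler_pdivrMr.
rewrite -(subnKC tk).
pose A (J : {set 'I_n.+1}) := (1 <= #|J|)%N.
pose B (J : {set 'I_n.+1}) := (M <= #|J|)%N.
have vA : A [set v n]%SET by rewrite /A cards1.
have := @iter_markov_compose R _ (G n) q q01 P A B t (k - t)
  (fun J => (~~ (eps * n.+1%:R <= #|J|%:R))%:R) (err / 2) (@step_closed_card _ P 1) (ltW err20).
move=> h; apply: (le_trans (h _ _ _ vA)) => [J _ BJ|J|].
- apply: le_trans (hk (k - t)%N _); last first.
    by rewrite natrB // lerBrDr.
  have clB : step_closed P (fun J : {set 'I_n.+1} => eps * n.+1%:R <= #|J|%:R).
    move=> I c /le_trans; apply; rewrite ler_nat.
    by apply: subset_leq_card; exact: step_sub.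
  (* Here 1 / |I| lies between 1 / N and 1, so Markov's inequality costs a factor N, which a log n
     rounds pay for. *)
  apply: le_trans (@phase_bound R _ (G n) q q01 P B _ (k - t) (fun J => (#|J|%:R)^-1) kap (n.+1%:R)^-1
    (@step_closed_card _ P M) clB kap0 _ _ _ _ _ BJ) _.
  + by rewrite invr_gt0 ltr0n.
  + by move=> I; rewrite invr_ge0 ler0n.
  + move=> I BI; rewrite -ltNge => /ltW hI.
    have I0 : (0 < #|I|)%N by apply: leq_trans BI.
    have dr := drift _ (G n) I (ltn0Sn n) nr hI.
    apply: le_trans (markov_inv_card_le_large q01 I0 m0 dr) _.
    rewrite ler_wpM2r ?invr_ge0 ?ler0n // -lerBrDl; apply: le_trans MV.
    by rewrite lef_pV2 ?posrE ?ltr0n // ler_nat.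
  + move=> I BI _; have I0 : (0 < #|I|)%N by apply: leq_trans BI.
    rewrite lef_pV2 ?posrE ?ltr0n // ler_nat.
    by rewrite -[X in (_ <= X)%N]card_ord max_card.
  rewrite invrK ler_wpM2r ?ler0n // ler_piMr ?exprn_ge0 //.
  by rewrite invf_le1 ?ler1n ?ltr0n // (leq_trans _ BJ).
- by case: (eps * n.+1%:R <= _).
rewrite [leRHS](splitr err) lerD2l.
have /andP[kapa0 _] := kapa01.
apply: le_trans (@phase_bound R _ (G n) q q01 P A B t (fun J => (#|J|%:R)^-1) kapa (M%:R)^-1
  (@step_closed_card _ P 1) (@step_closed_card _ P M) kapa0 _ _ _ _ _ vA) _.
- by rewrite invr_gt0.
- by move=> I; rewrite invr_ge0 ler0n.
- move=> I AI; rewrite /B -ltnNge => BI.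
  have dr : mean_missed (G n) q P I <= #|~: I|%:R - m * #|I|%:R.
    by apply: drift => //; apply: le_trans hM'; rewrite ler_nat ltnW.
  have I0 : (0 < #|I|)%N := AI.
  by apply: le_trans (markov_inv_card_le_any q01 I0 m0 dr) _; rewrite lexx.
- move=> I AI; rewrite /B -ltnNge => BI.
  by rewrite lef_pV2 ?posrE ?ltr0n // ler_nat ltnW.
by rewrite cards1 invr1 mulr1 invrK -ler_pdivlMr.
Qed.

(** |U| has to fall from at most N to eps3 N, a constant ratio, so a constant number of contracting
    rounds is enough. *)
Lemma phase_contract (eps eps3 err : R) : 0 < eps <= 1 -> 0 < eps3 -> 0 < err ->
  exists t : nat, \forall n \near eventually, forall I : {set 'I_n.+1},
    eps * n.+1%:R <= #|I|%:R ->
    iter t (mk n) (fun J => (~~ (#|~: J|%:R <= eps3 * n.+1%:R))%:R) I <= err.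
Proof.
move=> eps01 eps30 err0.
have [kap [eta [/andP[kap0 kap1] eta0 drift]]] := contract_drift P q01 eps01.
have [||t ht] := @pow_small kap (err * eps3); [by rewrite kap0|by rewrite mulr_gt0|].
exists t; apply: filterS (expander_near_regular expG eta0) => n nr I hI.
have N0 : 0 < n.+1%:R :> R by rewrite ltr0n.
pose A (J : {set 'I_n.+1}) := eps * n.+1%:R <= #|J|%:R.
pose B (J : {set 'I_n.+1}) := #|~: J|%:R <= eps3 * n.+1%:R.
have clA : step_closed P A.
  move=> J c /le_trans; apply; rewrite ler_nat.
  by apply: subset_leq_card; exact: step_sub.
have clB : step_closed P B.
  move=> J c; apply: le_trans; rewrite ler_nat; apply: subset_leq_card.
  by rewrite finset.setCS; exact: step_sub.
apply: le_trans (@phase_bound R _ (G n) q q01 P A B t (fun J => #|~: J|%:R) kap (eps3 * n.+1%:R)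
  clA clB kap0 _ _ _ _ _ hI) _.
- by rewrite mulr_gt0.
- by move=> J; rewrite ler0n.
- move=> J AJ _; rewrite /markov expect_card_missed; apply: drift => //.
  by rewrite card_setC_natr card_ord mulrBl mul1r lerD2l lerN2.
- by move=> J _; rewrite /B -ltNge => /ltW.
rewrite ler_pdivrMr ?mulr_gt0 // mulrA.
apply: ler_pM => //; first by rewrite exprn_ge0.
by rewrite ler_nat -[X in (_ <= X)%N]card_ord max_card.
Qed.

(** Initially |U| <= N, and |U| >= 1 until the end, so failure has probability at most [kap]^k N.
    When rho = 0 every positive a is admissible. *)
Lemma phase_decay (a : R) : 0 < a -> rho < expR (- a^-1) ->
  exists eps3 : R, 0 < eps3 /\ forall err : R, 0 < err ->
    \forall n \near eventually, forall I : {set 'I_n.+1}, #|~: I|%:R <= eps3 * n.+1%:R ->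
      forall k : nat, a * L n <= k%:R ->
      iter k (mk n) (fun J => (J != [set: 'I_n.+1]%SET)%:R) I <= err.
Proof.
move=> a0 ra; pose kap := (rho + expR (- a^-1)) / 2.
have rho0 : 0 <= rho.
  rewrite mulr_ge0 ?expR_ge0 // subr_ge0; case/andP: q01 => q0 q1.
  by rewrite mulr_ile1 ?ler0n ?(ltW q0) //; case: (pulls P).
have kapP : 0 <= kap < expR (- a^-1).
  have := expR_gt0 (- a^-1); rewrite /kap; lra.
have [|eps3 [eta [/andP[eps30 _] eta0 drift]]] := @decay_drift R q P q01 kap; first by rewrite /kap; lra.
exists eps3; split => // err err0.
apply: filterS2 (expander_near_regular expG eta0) (pow_ln_small a0 kapP err0) => n nr hk I hI k ak.
apply: le_trans (hk k ak); have /andP[kap0 _] := kapP.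
pose A (J : {set 'I_n.+1}) := #|~: J|%:R <= eps3 * n.+1%:R.
have clA : step_closed P A.
  move=> J c; apply: le_trans; rewrite ler_nat; apply: subset_leq_card.
  by rewrite finset.setCS; exact: step_sub.
have clB : step_closed P (fun J : {set 'I_n.+1} => J == [set: 'I_n.+1]%SET).
  move=> J c /eqP ->; rewrite -finset.subTset; exact: step_sub.
apply: le_trans (@phase_bound R _ (G n) q q01 P A _ k (fun J => #|~: J|%:R) kap 1
  clA clB kap0 _ _ _ _ _ hI) _ => //.
- by move=> J AJ _; rewrite /markov expect_card_missed; apply: drift.
- move=> J _ JT; rewrite ler1n lt0n cards_eq0.
  by apply: contra JT => /eqP h; rewrite -[J]finset.setCK h finset.setC0.
rewrite divr1 ler_wpM2l ?exprn_ge0 //.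
by rewrite ler_nat -[X in (_ <= X)%N]card_ord max_card.
Qed.

Lemma informed_whp (a1 a3 err : R) : 0 < a1 -> expR a1^-1 < 1 + gamma ->
  0 < a3 -> rho < expR (- a3^-1) -> 0 < err ->
  exists c0 : nat, \forall n \near eventually, forall k : nat,
    (a1 + a3) * L n + c0%:R <= k%:R ->
    iter k (mk n) (fun J => (J != [set: 'I_n.+1]%SET)%:R) [set v n]%SET <= err.
Proof.
move=> a10 ag a30 ra err0; have err30 : 0 < err / 3 by rewrite divr_gt0.
have [eps [eps01 /(_ _ err30)[c1 ev1]]] := phase_growth a10 ag.
have [eps3 [eps30 /(_ _ err30) ev3]] := phase_decay a30 ra.
have [t2 ev2] := phase_contract eps01 eps30 err30.
exists (c1 + t2 + 1)%N; apply: filterS3 ev1 ev2 ev3 => n h1 h2 h3 k hk.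
have L0 : 0 <= L n by rewrite ln_ge0 // ler1n.
have aL0 : 0 <= a1 * L n by rewrite mulr_ge0 // ltW.
(* Rounding down a1 log n loses less than one round; the 1 added here, and in c0, makes up for
   it. *)
pose k1 := (Num.truncn (a1 * L n) + c1 + 1)%N.
have tr : (Num.truncn (a1 * L n))%:R <= a1 * L n by rewrite truncn_le.
have k1t : (k1 + t2 <= k)%N.
  have a3L : 0 <= a3 * L n by rewrite mulr_ge0 // ltW.
  by rewrite -(ler_nat R); apply: le_trans hk; rewrite /k1 !natrD; lra.
rewrite -(subnKC k1t) -addnA.
pose g := fun J : {set 'I_n.+1} => (J != [set: 'I_n.+1]%SET)%:R : R.
have g1 J : g J <= 1 by rewrite /g; case: (J != _).
apply: le_trans (@iter_markov_compose R _ (G n) q q01 P xpredT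
  (fun J => eps * n.+1%:R <= #|J|%:R) k1 _ g (err / 3 + err / 3) (@step_closedT _ P) _ _ g1 _ isT) _.
- by rewrite addr_ge0 // ltW.
- move=> I _ hI; apply: le_trans (@iter_markov_compose R _ (G n) q q01 P xpredT
    (fun J => #|~: J|%:R <= eps3 * n.+1%:R) t2 _ g (err / 3) (@step_closedT _ P) (ltW err30) _ g1 _ isT) _.
    move=> J _ hJ; apply: h3 => //.
    rewrite natrB //; move: hk; rewrite /k1 !natrD; lra.
  by rewrite lerD2l h2.
have : iter k1 (mk n) (fun J => (~~ (eps * n.+1%:R <= #|J|%:R))%:R) [set v n]%SET <= err / 3.
  apply: h1; rewrite /k1 !natrD.
  have : a1 * L n < (Num.truncn (a1 * L n)).+1%:R by rewrite truncnS_gt.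
  by rewrite -addn1 natrD; lra.
by lra.
Qed.

(** The mean of |I| after k rounds is at most [kap]^k, so Markov's inequality at level N / 2 gives 2
    [kap]^k / N. *)
Lemma phase_growth_lower (a err : R) : 0 < a -> 1 + gamma < expR a^-1 -> 0 < err ->
  \forall n \near eventually, forall k : nat, k%:R <= a * L n ->
    iter k (mk n) (fun J => (~~ (#|J|%:R <= n.+1%:R / 2 :> R))%:R) [set v n]%SET <= err.
Proof.
move=> a0 ga err0; pose kap := (1 + gamma + expR a^-1) / 2.
have g0 : 0 <= gamma := growth_rate_ge0 q01 P.
have kapP : 1 <= kap < expR a^-1 by rewrite /kap; lra.
have [|eta [eta0 drift]] := @growth_upper R q P q01 kap; first by rewrite /kap; lra.
have err20 : 0 < err / 2 by rewrite divr_gt0.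
apply: filterS2 (expander_near_regular expG eta0) (pow_ln_small_growth a0 kapP err20) => n nr hk k ak.
have N0 : 0 < n.+1%:R / 2 :> R by rewrite divr_gt0 // ltr0n.
have kap0 : 0 <= kap by case/andP: kapP => h _; apply: le_trans h.
have clB : step_closed P (fun J : {set 'I_n.+1} => ~~ (#|J|%:R <= n.+1%:R / 2 :> R)).
  move=> I c; rewrite -!ltNge => /lt_le_trans; apply; rewrite ler_nat.
  by apply: subset_leq_card; exact: step_sub.
apply: le_trans (_ : iter k (mk n) (fun J => (n.+1%:R / 2)^-1 * #|J|%:R) [set v n]%SET <= _).
  apply: (@ler_iter_markov_on R _ (G n) q q01 P xpredT) => // J _.
  rewrite [leRHS]mulrC ler_pdivlMr //; case: (leP (#|J|%:R : R) (n.+1%:R / 2)) => [_|/ltW h].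
    by rewrite /= mulr0n mul0r ler0n.
  by rewrite /= mulr1n mul1r.
rewrite iter_markovZ.
have := @iter_markov_decay R _ (G n) q q01 P xpredT k (fun J => #|J|%:R) kap (@step_closedT _ P) kap0
  (fun I _ => drift _ (G n) I (ltn0Sn n) nr) [set v n]%SET isT.
rewrite cards1 mulr1 => h.
have := hk k ak => h'.
apply: le_trans (_ : (n.+1%:R / 2)^-1 * kap ^+ k <= _).
  by rewrite ler_wpM2l // invr_ge0 ltW.
rewrite invf_div [leLHS]mulrAC -mulrA.
by set x := kap ^+ k / _ in h' *; lra.
Qed.

(** K / (K + |U|) is 1 when all vertices are informed and at most 2 K / N at the start, so
    completion after k rounds has probability at most 2 K [kap]^k / N. *)
Lemma phase_decay_lower (a err : R) : 0 < a -> expR (- a^-1) < rho -> 0 < err ->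
  \forall n \near eventually, forall I : {set 'I_n.+1}, #|I|%:R <= (n.+1%:R / 2 : R) ->
    forall k : nat, k%:R <= a * L n ->
    iter k (mk n) (fun J => (J == [set: 'I_n.+1]%SET)%:R) I <= err.
Proof.
move=> a0 ar err0; pose r := (expR (- a^-1) + rho) / 2.
have e0 := expR_gt0 (- a^-1).
have r0 : 0 < r by rewrite /r; lra.
have rr : r < rho by rewrite /r; lra.
have er : expR (- a^-1) < r by rewrite /r; lra.
have rho1 : rho <= 1.
  rewrite /decay_rate mulr_ile1 ?expR_ge0 //.
  - by case/andP: q01 => q0 q1; rewrite subr_ge0 mulr_ile1 ?ler0n ?(ltW q0) //; case: (pulls P).
  - by rewrite expR_le1 oppr_le0 mulr_ge0 ?ler0n //; case/andP: q01 => q0 _; rewrite ltW.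
  - by rewrite gerBl mulr_ge0 ?ler0n //; case/andP: q01 => q0 _; rewrite ltW.
have rE : r^-1 < expR a^-1.
  by rewrite -[ltRHS]invrK -expRN ltf_pV2 ?posrE.
pose dl := (expR a^-1 - r^-1) / 2.
have dl0 : 0 < dl by rewrite divr_gt0 // subr_gt0.
(* This K makes the factor of [markov_inv_shift_le] equal to 1 / r + dl, halfway to e^(1/a). *)
pose K := (r ^+ 2 * dl)^-1.
have K0 : 0 < K by rewrite invr_gt0 mulr_gt0 // exprn_gt0.
pose kap := r^-1 + dl.
have kapK : r^-1 * (1 + (r * K)^-1) = kap.
  by rewrite /kap /K; field; rewrite !gt_eqF.
have r1 : 1 <= r^-1 by rewrite invf_ge1 //; apply: le_trans rho1; exact: ltW.
have kapP : 1 <= kap < expR a^-1 by rewrite /kap /dl; lra.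
have [|eta [eta0 drift]] := @decay_lower R q P q01 r; first by rewrite r0.
have errK : 0 < err / (2 * K) by rewrite divr_gt0 // mulr_gt0.
apply: filterS2 (expander_near_regular expG eta0) (pow_ln_small_growth a0 kapP errK) => n nr hk I hI k ak.
have N0 : 0 < n.+1%:R :> R by rewrite ltr0n.
have kap0 : 0 <= kap by case/andP: kapP => h _; apply: le_trans h.
apply: le_trans (_ : iter k (mk n) (fun J => K * (K + #|~: J|%:R)^-1) I <= _).
  apply: (@ler_iter_markov_on R _ (G n) q q01 P xpredT) => // J _.
  case: eqP => [->|_] /=; first by rewrite finset.setCT cards0 addr0 divff ?gt_eqF.
  by rewrite divr_ge0 ?addr_ge0 ?ler0n // ltW.
rewrite iter_markovZ.
have rP : 0 < r <= 1 by rewrite r0 (le_trans (ltW rr)).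
have h := @iter_markov_decay R _ (G n) q q01 P xpredT k (fun J => (K + #|~: J|%:R)^-1) kap
  (@step_closedT _ P) kap0 _ I isT.
apply: le_trans (_ : K * (kap ^+ k * (K + #|~: I|%:R)^-1) <= _).
  rewrite ler_wpM2l ?(ltW K0) //; apply: h => J _.
  by rewrite -kapK; apply: markov_inv_shift_le => //; exact: drift.
apply: le_trans (_ : K * (kap ^+ k * (n.+1%:R / 2)^-1) <= _).
  rewrite ler_wpM2l ?(ltW K0) // ler_wpM2l ?exprn_ge0 // lef_pV2 ?posrE ?divr_gt0 //.
    by rewrite card_setC_natr card_ord; move: hI; lra.
  by rewrite ltr_wpDr.
have := hk k ak; rewrite ler_pdivlMr ?mulr_gt0 // => h'.
apply: le_trans h'; rewrite invf_div le_eqVlt; apply/orP; left; apply/eqP; ring.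
Qed.

(** Replaces [not_informed_whp] when [decay_rate] is 0 and only the growth phase takes time of order
    log n. *)
Lemma not_informed_growth (a err : R) : 0 < a -> 1 + gamma < expR a^-1 -> 0 < err ->
  \forall n \near eventually, forall k : nat, k%:R <= a * L n ->
    iter k (mk n) (fun J => (J == [set: 'I_n.+1]%SET)%:R) [set v n]%SET <= err.
Proof.
move=> a0 ga err0; apply: filterS (phase_growth_lower a0 ga err0) => n h k ak.
apply: le_trans (h k ak); apply: (@ler_iter_markov_on R _ (G n) q q01 P xpredT) => // J _.
case: eqP => [->|_]; last by rewrite ler0n.
have N0 : 0 < n.+1%:R :> R by rewrite ltr0n.
rewrite (_ : (#|[set: 'I_n.+1]%SET|%:R <= n.+1%:R / 2 :> R) = false) //.
by apply/negbTE; rewrite -ltNge cardsT card_ord ltr_pdivrMr // ltr_pMr // ltr1n.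
Qed.

Lemma not_informed_whp (a1 a3 err : R) : 0 < a1 -> 1 + gamma < expR a1^-1 ->
  0 < a3 -> expR (- a3^-1) < rho -> 0 < err ->
  \forall n \near eventually, forall k : nat, k%:R <= (a1 + a3) * L n - 1 ->
    iter k (mk n) (fun J => (J == [set: 'I_n.+1]%SET)%:R) [set v n]%SET <= err.
Proof.
move=> a10 ga a30 ar err0; have err20 : 0 < err / 2 by rewrite divr_gt0.
apply: filterS2 (phase_growth_lower a10 ga err20) (phase_decay_lower a30 ar err20) => n h1 h3 k hk.
have L0 : 0 <= L n by rewrite ln_ge0 // ler1n.
have aL0 : 0 <= a1 * L n by rewrite mulr_ge0 // ltW.
have tr : (Num.truncn (a1 * L n))%:R <= a1 * L n by rewrite truncn_le.
have tr1 : a1 * L n < (Num.truncn (a1 * L n)).+1%:R by rewrite truncnS_gt.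
(* k may be shorter than the first phase. Otherwise the - 1 in the bound on k pays for rounding down
   a1 log n. *)
pose k1 := minn k (Num.truncn (a1 * L n)).
have k1k : (k1 <= k)%N by rewrite geq_minl.
rewrite -(subnKC k1k).
apply: le_trans (@iter_markov_compose R _ (G n) q q01 P xpredT
  (fun J => #|J|%:R <= (n.+1%:R / 2 : R)) k1 (k - k1) _ (err / 2) (@step_closedT _ P) (ltW err20) _ _ _ isT) _.
- move=> J _ hJ; apply: h3 => //; rewrite natrB // /k1.
  case: leqP => kt; first by rewrite subrr mulr_ge0 // ltW.
  by move: tr1 hk; rewrite -addn1 natrD; lra.
- by move=> J; case: eqP.
rewrite [leRHS](splitr err) lerD2l; apply: h1.
by apply: le_trans tr; rewrite ler_nat geq_minr.
Qed.

End Asymptotics.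
(* Turns the tolerance eps * log n, for every eps, into a single tolerance that is o(log n). *)
Lemma diagonal_extraction (R : realType) (F : R -> nat -> R) :
  (forall eps n, F eps n <= 1) ->
  (forall eps err, 0 < eps -> 0 < err -> \forall n \near eventually, 1 - err <= F eps n) ->
  exists eps : nat -> R, [/\ forall n, 0 < eps n,
    (eps @ eventually --> (0 : R))%classic &
    ((fun n => F (eps n) n) @ eventually --> (1 : R))%classic].
Proof.
move=> F1 Flim; pose u (k : nat) : R := (k.+1%:R)^-1.
have u0 k : 0 < u k by rewrite invr_gt0 ltr0n.
have uN k j : (k <= j)%N -> u j <= u k by move=> kj; rewrite lef_pV2 ?posrE ?ltr0n // ler_nat.
(* [Q n k] says that tolerance 1 / (k + 1) is met from n on for good; the largest such k up to n
   tends to infinity with n. *)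
pose Q n (k : nat) := `[< 1 - u k <= F (u k) n /\ forall m, (n <= m)%N -> 1 - u k <= F (u k) m >].
pose K n := \max_(k < n.+1 | Q n k) k.
have Kspec j : \forall n \near eventually, (j <= K n)%N /\ 1 - u (K n) <= F (u (K n)) n.
  have [n0 _ hn0] := Flim (u j) (u j) (u0 j) (u0 j).
  exists (maxn n0 j) => // n /=; rewrite geq_max => /andP[n0n jn].
  have Qj : Q n j.
    apply/asboolP; split; first exact: hn0.
    by move=> m nm; apply: hn0 => /=; exact: leq_trans nm.
  have jn' : (j < n.+1)%N by [].
  split; first exact: (@leq_bigmax_cond _ _ (fun k : 'I_n.+1 => k : nat) (Ordinal jn')).
  have [|i Qi Ki] := @eq_bigmax_cond _ (fun k : 'I_n.+1 => Q n k) (fun k : 'I_n.+1 => k : nat).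
    by apply/card_gt0P; exists (Ordinal jn').
  by rewrite /K Ki; move: Qi => /asboolP[].
have usmall (e : R) : 0 < e -> exists j, u j <= e.
  move=> e0; exists (Num.truncn e^-1); rewrite -[leRHS]invrK lef_pV2 ?posrE ?invr_gt0 ?ltr0n //.
  by rewrite ltW // truncnS_gt.
exists (fun n => u (K n)); split => //.
- apply/cvgrPdist_le => e /usmall[j uj]; apply: filterS (Kspec j) => n [jK _] /=.
  by rewrite sub0r normrN gtr0_norm // (le_trans (uN _ _ jK)).
- apply/cvgrPdist_le => e /usmall[j uj]; apply: filterS (Kspec j) => n [jK FK] /=.
  rewrite ger0_norm ?subr_ge0 // lerBlDr -lerBlDl; apply: le_trans FK.
  by rewrite lerD2l lerN2 (le_trans (uN _ _ jK)).
Qed.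

(** * From rates to the running time, and the constants at q = 1 *)

Section Spreading.
Variable R : realType.

(** h1 = 1 / log (1 + g) and h3 = 1 / log (1 / r) are the lengths of the growth and decay phases in
    units of log n; r = 0 corresponds to h3 = 0. *)
Lemma whp_time_of_rates (G : forall n : nat, rel 'I_n.+1) (q : R) (P : protocol)
    (v : forall n : nat, 'I_n.+1) (h1 h3 : R) :
  expander_sequence R G -> 0 < q <= 1 ->
  0 < h1 -> 1 + growth_rate q P = expR h1^-1 ->
  (h3 = 0 /\ decay_rate q P = 0) \/ (0 < h3 /\ decay_rate q P = expR (- h3^-1)) ->
  c_protocol P q = h1 + h3 ->
  whp_time G P q v.
Proof.
move=> expG q01 h10 gE rE cE.
have h30 : 0 <= h3 by case: rE => [[->]|[/ltW]].
pose F (eps : R) n := Prob_T_between (G n) P q (v n)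
  (c_protocol P q * ln n.+1%:R - eps * ln n.+1%:R) (c_protocol P q * ln n.+1%:R + eps * ln n.+1%:R).
have F1 eps n : F eps n <= 1 by exact: Pr_rounds_le1.
have [eps err eps0 err0|eps [eps0 epslim Flim]] := diagonal_extraction F1.
  have err20 : 0 < err / 2 by rewrite divr_gt0.
  (* Each phase gets eps / 4 of slack; the remaining eps / 2 log n absorbs c0 and the truncation. *)
  pose a1 := h1 + eps / 4; pose a3 := h3 + eps / 4.
  have a10 : 0 < a1 by rewrite /a1; lra.
  have a30 : 0 < a3 by rewrite /a3; lra.
  have ag : expR a1^-1 < 1 + growth_rate q P.
    by rewrite gE ltr_expR ltf_pV2 ?posrE // /a1; lra.
  have ar : decay_rate q P < expR (- a3^-1).
    case: rE => [[_ ->]|[h3p ->]]; first exact: expR_gt0.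
    by rewrite ltr_expR ltrN2 ltf_pV2 ?posrE // /a3; lra.
  have [c0 up] := informed_whp expG q01 v a10 ag a30 ar err20.
  (* The maximum with 0 covers a negative lower end, whose [truncn] is 0. *)
  have low : \forall n \near eventually, forall k : nat,
      k%:R <= Num.max 0 ((h1 + h3 - eps) * ln n.+1%:R) ->
      iter k (markov (G n) q P) (fun J => (J == [set: 'I_n.+1]%SET)%:R) [set v n]%SET <= err / 2.
    (* The slack taken off h1 or h3 must be below eps / 4 and also leave a positive length. *)
    have mins (x y : R) : 0 < x -> 0 < y -> exists z, [/\ 0 < z, z < x & z <= y].
      move=> x0 y0; exists (Num.min (x / 2) y); rewrite lt_min y0 divr_gt0 //; split => //.
        by rewrite gt_min; apply/orP; left; lra.
      by rewrite ge_min lexx orbT.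
    have [d1 [d10 d1h d1e]] := mins h1 (eps / 4) h10 (divr_gt0 eps0 (ltr0n _ 4)).
    have b10 : 0 < h1 - d1 by rewrite subr_gt0.
    have bg : 1 + growth_rate q P < expR (h1 - d1)^-1.
      by rewrite gE ltr_expR ltf_pV2 ?posrE //; lra.
    case: rE => [[h3z _]|[h3p rE]].
      have := not_informed_growth expG q01 v b10 bg err20.
      apply: filterS2 (ln_nat_large 0) => n L0 h k hk; apply: h; apply: le_trans hk _.
      rewrite ge_max; apply/andP; split; first exact: mulr_ge0 (ltW b10) L0.
      by apply: ler_wpM2r; [exact: L0 | rewrite h3z; lra].
    have [d3 [d30 d3h d3e]] := mins h3 (eps / 4) h3p (divr_gt0 eps0 (ltr0n _ 4)).
    have b30 : 0 < h3 - d3 by rewrite subr_gt0.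
    have br : expR (- (h3 - d3)^-1) < decay_rate q P.
      by rewrite rE ltr_expR ltrN2 ltf_pV2 ?posrE //; lra.
    have := not_informed_whp expG q01 v b10 bg b30 br err20.
    apply: filterS3 (ln_nat_large (h1 - d1)^-1) (ln_nat_large (eps / 2)^-1) => n L1 L2 h k hk.
    apply: h; apply: le_trans hk _.
    have L0 : 0 <= ln (n.+1%:R : R) by rewrite ln_ge0 // ler1n.
    rewrite ge_max; apply/andP; split.
      rewrite subr_ge0 mulrDl.
      have : 1 <= (h1 - d1) * ln n.+1%:R by rewrite -ler_pdivrMl // mulr1.
      have : 0 <= (h3 - d3) * ln (n.+1%:R : R) by rewrite mulr_ge0 // ltW.
      by lra.
    have e2 : 0 < eps / 2 by rewrite divr_gt0.
    have : 1 <= eps / 2 * ln n.+1%:R by rewrite -ler_pdivrMl // mulr1.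
    have : (h1 + h3 - eps) * ln (n.+1%:R : R) <= (h1 - d1 + (h3 - d3) - eps / 2) * ln (n.+1%:R : R).
      by rewrite ler_wpM2r //; lra.
    by rewrite mulrBl; lra.
  have e2 : 0 < eps / 2 by rewrite divr_gt0.
  apply: filterS3 up low (filterI (nbhs_infty_gt 0) (ln_nat_large ((c0%:R + 1) / (eps / 2)))).
  move=> n hup hlow [n0 Ln]; rewrite /F cE -mulrBl -mulrDl.
  have L0 : 0 <= ln (n.+1%:R : R) by rewrite ln_ge0 // ler1n.
  have v1 : [set v n]%SET != [set: 'I_n.+1]%SET.
    apply/eqP => /(congr1 (fun A : {set 'I_n.+1} => #|A|)); rewrite cards1 cardsT card_ord => -[n0'].
    by move: n0; rewrite -n0'.
  have b0 : 0 <= (h1 + h3 + eps) * ln (n.+1%:R : R).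
    by rewrite mulr_ge0 // !addr_ge0 // ltW.
  have ab : (Num.truncn ((h1 + h3 - eps) * ln (n.+1%:R : R)) <= Num.truncn ((h1 + h3 + eps) * ln (n.+1%:R : R)))%N.
    by apply: le_truncn; rewrite ler_wpM2r //; lra.
  apply: le_trans (Prob_T_between_ge (G n) q01 P b0 ab v1).
  have hu := hup (Num.truncn ((h1 + h3 + eps) * ln (n.+1%:R : R))).
  have hl := hlow (Num.truncn ((h1 + h3 - eps) * ln (n.+1%:R : R))).
  rewrite -addrA -opprD lerD2l lerN2 [leRHS](splitr err); apply: lerD.
    apply: hu; have : (h1 + h3 + eps) * ln (n.+1%:R : R) <
        (Num.truncn ((h1 + h3 + eps) * ln (n.+1%:R : R))).+1%:R by rewrite truncnS_gt.
    rewrite -[X in _ < X]natr1.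
    move: Ln; rewrite ler_pdivrMr // => Ln.
    have -> : (a1 + a3) * ln (n.+1%:R : R) = (h1 + h3 + eps) * ln (n.+1%:R : R) - ln (n.+1%:R : R) * (eps / 2).
      by rewrite /a1 /a3; field.
    by lra.
  apply: hl; rewrite le_max.
  have [x0|x0] := leP 0 ((h1 + h3 - eps) * ln (n.+1%:R : R)).
    by rewrite truncn_le x0 orbT.
  by have := le_truncn (ltW x0); rewrite truncn0 leqn0 => /eqP ->; rewrite lexx.
(* At n = 0 the logarithm vanishes, but the tolerance has to be positive there too. *)
pose g n := if (0 < n)%N then eps n * ln n.+1%:R else 1.
have gE' : \forall n \near eventually, 0 < ln (n.+1%:R : R) /\ g n = eps n * ln n.+1%:R.
  near=> n; have n0 : (0 < n)%N by near: n; exact: nbhs_infty_gt.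
  by rewrite /g n0; split => //; rewrite ln_gt0 // ltr1n.
exists g; split; first by move=> n; rewrite /g; case: ifP => // n0; rewrite mulr_gt0 // ln_gt0 // ltr1n.
split.
  apply: cvg_trans epslim; apply: near_eq_cvg; apply: filterS gE' => n [L0 ->].
  by rewrite mulfK // gt_eqF.
apply: cvg_trans Flim; apply: near_eq_cvg; apply: filterS gE' => n [_ ->].
by [].
Unshelve. all: by end_near. Qed.

Lemma cvg_inv_ln_left (k : R) : 0 < k ->
  ((fun x : R => 1 / ln (1 + k * x)) @ at_left (1 : R) --> (ln (1 + k))^-1)%classic.
Proof.
move=> k0; rewrite -[X in (_ --> X)%classic]mul1r.
apply: cvgM; first exact: cvg_cst.
apply: cvgV; first by rewrite gt_eqF // ln_gt0 // ltrDl.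
have cf : ((fun x : R => 1 + k * x) @ at_left (1 : R) --> 1 + k)%classic.
  rewrite -{2}[k]mulr1; apply: cvgD; first exact: cvg_cst.
  apply: cvgM; first exact: cvg_cst.
  exact: cvg_at_left_filter cvg_id.
apply: (cvg_comp _ _ cf); apply: continuous_ln.
by rewrite addr_gt0.
Qed.

Lemma lim_cpush : lim (cpush_f x @[x --> at_left (1 : R)])%classic = (ln 2)^-1 + 1.
Proof.
apply: cvg_lim => //; rewrite /cpush_f.
have h : ((fun x : R => 1 / ln (1 + 1 * x)) @ at_left (1 : R) --> (ln 2)^-1)%classic.
  by rewrite (_ : 2 = 1 + 1); [exact: cvg_inv_ln_left | ring].
apply: cvgD.
  by under eq_fun do rewrite -[X in ln (1 + X)]mul1r; exact: h.
rewrite -[X in (_ --> X)%classic](divr1 1); apply: cvgM; first exact: cvg_cst.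
apply: cvgV; first exact: oner_neq0.
exact: cvg_at_left_filter cvg_id.
Qed.

(** Makes the second summands of [cpull_f] and [cpp_f] vanish in the limit at 1, in accordance with
    h3 = 0. *)
Lemma ln1B_left_small (e : R) : 0 < e ->
  \forall x \near at_left (1 : R), 0 < x < 1 /\ ln (1 - x) <= - e^-1.
Proof.
move=> e0; have E0 := expR_gt0 (- e^-1).
near=> x.
have x1 : x < 1 by near: x; exact: nbhs_left_lt.
have x0 : 0 < x by near: x; exact: nbhs_left_gt.
rewrite x0 x1; split => //.
rewrite -(expRK (- e^-1)) ler_ln ?posrE ?subr_gt0 //.
rewrite lerBlDl -lerBlDr ltW //.
near: x; apply: nbhs_left_gt; rewrite ltrBlDr ltrDl //.
Unshelve. all: by end_near. Qed.

Lemma lim_cpull : lim (cpull_f x @[x --> at_left (1 : R)])%classic = (ln 2)^-1.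
Proof.
apply: cvg_lim => //; rewrite /cpull_f.
have h : ((fun x : R => 1 / ln (1 + 1 * x)) @ at_left (1 : R) --> (ln 2)^-1)%classic.
  by rewrite (_ : 2 = 1 + 1); [exact: cvg_inv_ln_left | ring].
rewrite -[X in (_ --> X)%classic]subr0; apply: cvgB.
  by under eq_fun do rewrite -[X in ln (1 + X)]mul1r; exact: h.
apply/cvgrPdist_le => e e0; apply: filterS (ln1B_left_small e0) => x [_ hx].
have ei : 0 < e^-1 by rewrite invr_gt0.
have l0 : ln (1 - x) < 0 by lra.
rewrite sub0r normrN div1r normfV ltr0_norm //.
by rewrite -[leRHS]invrK lef_pV2 ?posrE ?oppr_gt0 // lerNr.
Qed.

Lemma lim_cpp : lim (cpp_f x @[x --> at_left (1 : R)])%classic = (ln 3)^-1.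
Proof.
apply: cvg_lim => //; rewrite /cpp_f.
have h : ((fun x : R => 1 / ln (1 + 2 * x)) @ at_left (1 : R) --> (ln 3)^-1)%classic.
  by rewrite (_ : 3 = 1 + 2); [exact: cvg_inv_ln_left | ring].
rewrite -[X in (_ --> X)%classic]addr0; apply: cvgD; first exact: h.
apply/cvgrPdist_le => e e0; apply: filterS (ln1B_left_small e0) => x [/andP[x0 x1] hx].
have ei : 0 < e^-1 by rewrite invr_gt0.
have l0 : e^-1 <= x - ln (1 - x) by lra.
have l1 : 0 < x - ln (1 - x) by apply: lt_le_trans l0.
rewrite sub0r normrN div1r gtr0_norm ?invr_gt0 //.
by rewrite -[leRHS]invrK lef_pV2 ?posrE.
Qed.

End Spreading.

Unset Implicit Arguments.

Theorem theorem1p4 (R : realType) (G : forall n : nat, rel 'I_n.+1) (q : R) :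
  expander_sequence R G -> 0 < q <= 1 ->
  forall v : forall n : nat, 'I_n.+1,
    [/\ whp_time G Push q v, whp_time G Pull q v & whp_time G PushPull q v].
Proof.
move=> expG q01 v; have /andP[q0 q1] := q01.
have lnk (k : R) : 0 < k -> 0 < (ln (1 + k))^-1 /\ 1 + k = expR ((ln (1 + k))^-1)^-1.
  move=> k0; rewrite invr_gt0 ln_gt0 ?ltrDl // invrK lnK // posrE addr_gt0 //.
split.
- have [h1 gE] := lnk q q0.
  apply: (@whp_time_of_rates _ _ _ _ _ (ln (1 + q))^-1 q^-1) => //.
  + by rewrite /growth_rate /= addr0 mulr1.
  + by right; rewrite invr_gt0 q0 invrK /decay_rate /= mulr0 subr0 !mulr1.
  + rewrite /= /cconst; case: ltP => [_|q1']; first by rewrite /cpush_f !div1r.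
    have -> : q = 1 by apply/eqP; rewrite eq_le q1 q1'.
    by rewrite lim_cpush invr1.
- have [h1 gE] := lnk q q0.
  have gE' : 1 + growth_rate q Pull = expR ((ln (1 + q))^-1)^-1.
    by rewrite /growth_rate /= add0r mulr1.
  have [q1'|q1'] := ltP q 1.
    have l0 : ln (1 - q) < 0 by rewrite ln_lt0 // subr_gt0 q1' gtrBl.
    apply: (@whp_time_of_rates _ _ _ _ _ (ln (1 + q))^-1 (- (ln (1 - q))^-1)) => //.
    + right; rewrite oppr_gt0 invr_lt0 l0 invrN invrK opprK lnK ?posrE ?subr_gt0 //.
      by rewrite /decay_rate /= mulr0 oppr0 expR0 mul1r mulr1.
    + by rewrite /= /cconst q1' /cpull_f !div1r.
  (* At q = 1 a vertex with only informed neighbours pulls with certain success, so [decay_rate] is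
     0. *)
  have qE : q = 1 by apply/eqP; rewrite eq_le q1 q1'.
  apply: (@whp_time_of_rates _ _ _ _ _ (ln (1 + q))^-1 0) => //.
  + by left; rewrite /decay_rate /= qE mulr1 subrr mulr0.
  + by rewrite /= /cconst qE ltxx lim_cpull addr0.
- have q20 : 0 < 2 * q by rewrite mulr_gt0.
  have [h1 gE] := lnk _ q20.
  have gE' : 1 + growth_rate q PushPull = expR ((ln (1 + 2 * q))^-1)^-1.
    by rewrite -gE /growth_rate /= -natrD mulrC.
  have [q1'|q1'] := ltP q 1.
    have l0 : ln (1 - q) < 0 by rewrite ln_lt0 // subr_gt0 q1' gtrBl.
    have s0 : 0 < q - ln (1 - q) by lra.
    apply: (@whp_time_of_rates _ _ _ _ _ (ln (1 + 2 * q))^-1 (q - ln (1 - q))^-1) => //.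
    + right; rewrite invr_gt0 s0 invrK opprB addrC expRD lnK ?posrE ?subr_gt0 //.
      by rewrite /decay_rate /= !mulr1.
    + by rewrite /= /cconst q1' /cpp_f !div1r.
  have qE : q = 1 by apply/eqP; rewrite eq_le q1 q1'.
  apply: (@whp_time_of_rates _ _ _ _ _ (ln (1 + 2 * q))^-1 0) => //.
  + by left; rewrite /decay_rate /= qE mulr1 subrr mulr0.
  + by rewrite /= /cconst qE ltxx lim_cpp addr0 mulr1; congr (ln _)^-1; ring.
Qed.
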